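(* Let $n\ge2$ and let $U=U_{r,s}(\mathfrak{so}_{2n+1})$ be as in the context, where $r$ is a primitive $d$-th root of unity, $s$ is a primitive $d'$-th root of unity, $r^3\ne s^3$, $r^4\ne s^4$, and $\ell=\mathrm{lcm}(d,d')$. Then the elements $\mathcal E_{k,j}^\ell$ $(1\le k\le j\le n)$, $\mathcal E_{k,j'}^\ell$ $(1\le k<j\le n)$, $\mathcal F_{k,j}^\ell$ $(1\le k\le j\le n)$, $\mathcal F_{k,j'}^\ell$ $(1\le k<j\le n)$ and $\omega_k^\ell-1$, $(\omega_k')^\ell-1$ $(1\le k\le n)$ are central in $U$.
   Context: $\mathbb K=\mathbb Q(r,s)$. $U_{r,s}(\mathfrak{so}_{2n+1})$ is the $\mathbb K$-algebra generated by $e_i,f_i,\omega_i^{\pm1},\omega_i'^{\pm1}$ ($1\le i\le n$) with: $\omega$'s commute, invertible; $\omega_je_i\omega_j^{-1}=\langle\omega_i',\omega_j\rangle e_i$, $\omega_jf_i\omega_j^{-1}=\langle\omega_i',\omega_j\rangle^{-1}f_i$, $\omega_j'e_i\omega_j'^{-1}=\langle\omega_j',\omega_i\rangle^{-1}e_i$, $\omega_j'f_i\omega_j'^{-1}=\langle\omega_j',\omega_i\rangle f_i$, where $\langle\omega_i',\omega_i\rangle=r^2s^{-2}$ ($i<n$), $\langle\omega_n',\omega_n\rangle=rs^{-1}$, $\langle\omega_i',\omega_{i+1}\rangle=r^{-2}$, $\langle\omega_{i+1}',\omega_i\rangle=s^2$ ($i<n$), others $1$; $e_if_j-f_je_i=\delta_{ij}(\omega_i-\omega_i')/(r_i-s_i)$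 ($r_i=r^2,s_i=s^2$ for $i<n$; $r_n=r,s_n=s$); Serre relations $(\mathrm{ad}_le_i)^{1-a_{ij}}(e_j)=0=(\mathrm{ad}_rf_i)^{1-a_{ij}}(f_j)$, $i\ne j$, with $(a_{ij})$ the $B_n$ Cartan matrix ($a_{ii}=2$, $a_{i,i+1}=a_{i+1,i}=-1$ for $i\le n-2$, $a_{n-1,n}=-1$, $a_{n,n-1}=-2$, else $0$), $\mathrm{ad}_l(a)(b)=\sum a_{(1)}bS(a_{(2)})$, $\mathrm{ad}_r(a)(b)=\sum S(a_{(1)})ba_{(2)}$, for the Hopf structure $\Delta(\omega)=\omega\otimes\omega$ on the $\omega$'s, $\Delta(e_i)=e_i\otimes1+\omega_i\otimes e_i$, $\Delta(f_i)=1\otimes f_i+f_i\otimes\omega_i'$, $S(e_i)=-\omega_i^{-1}e_i$, $S(f_i)=-f_i\omega_i'^{-1}$. Root vectors: $\mathcal E_{i,i}=e_i$, $\mathcal E_{i,j}=e_i\mathcal E_{i+1,j}-r^2\mathcal E_{i+1,j}e_i$ ($1\le i<j\le n$), $\mathcal E_{i,n'}=\mathcal E_{i,n}e_n-rs\,e_n\mathcal E_{i,n}$ ($i\le n-1$), $\mathcal E_{i,j'}=\mathcal E_{i,(j+1)'}e_j-s^{-2}e_j\mathcal E_{i,(j+1)'}$ ($1\le i<j\le n-1$); $\mathcal F_{i,i}=f_i$, $\mathcal F_{i,j}=\mathcal F_{i+1,j}f_i-s^2f_i\mathcal F_{i+1,j}$, $\mathcal F_{i,n'}=f_n\mathcal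 F_{i,n}-rs\,\mathcal F_{i,n}f_n$, $\mathcal F_{i,j'}=f_j\mathcal F_{i,(j+1)'}-r^{-2}\mathcal F_{i,(j+1)'}f_j$. *)

(* Defs.v *)
From HB Require Import structures.
From mathcomp Require Import all_boot all_order all_algebra.
Set Implicit Arguments. Unset Strict Implicit. Unset Printing Implicit Defensive.
Import Order.TTheory GRing.Theory Num.Theory.
Local Open Scope ring_scope.

(* Indices of generators are natural numbers 1..n (paper's convention). *)

Section UrsDefs.
Variables (F : fieldType) (r s : F) (n : nat).

(* The pairing <omega_i', omega_j> *)
Definition pairing (i j : nat) : F :=
  if i == j then (if (i < n)%N then r ^+ 2 / s ^+ 2 else r / s)
  else if (j == i.+1) && (i < n)%N then (r ^+ 2)^-1
  else if (i == j.+1) && (j < n)%N then s ^+ 2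
  else 1.

Definition ri (i : nat) : F := if (i < n)%N then r ^+ 2 else r.
Definition si (i : nat) : F := if (i < n)%N then s ^+ 2 else s.

Definition cartanB (i j : nat) : int :=
  if i == j then (2 : int)
  else if j == i.+1 then (-1 : int)
  else if i == j.+1 then (if i == n then (-2 : int) else (-1 : int))
  else (0 : int).

Variable (A : algType F).

(* ad_l(e_i)(b) = e_i b S(1) + omega_i b S(e_i) = e_i b - omega_i b omega_i^{-1} e_i *)
Definition adl_e (e w winv : nat -> A) (i : nat) (b : A) : A :=
  e i * b - w i * b * winv i * e i.
(* ad_r(f_i)(b) = S(1) b f_i + S(f_i) b omega_i' = b f_i - f_i omega_i'^{-1} b omega_i' *)
Definition adr_f (f w' w'inv : nat -> A) (i : nat) (b : A) : A :=
  b * f i - f i * w'inv i * b * w' i.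

(* A family of elements of A satisfying the defining relations of
   U_{r,s}(so_{2n+1}); i.e. a representation of U in the F-algebra A. *)
Record Urs_rep := {
  e : nat -> A; f : nat -> A;
  w : nat -> A; winv : nat -> A; w' : nat -> A; w'inv : nat -> A;
  w_inv : forall i, (1 <= i <= n)%N -> w i * winv i = 1 /\ winv i * w i = 1;
  w'_inv : forall i, (1 <= i <= n)%N -> w' i * w'inv i = 1 /\ w'inv i * w' i = 1;
  w_comm : forall i j, (1 <= i <= n)%N -> (1 <= j <= n)%N ->
    [/\ GRing.comm (w i) (w j), GRing.comm (w i) (w' j) & GRing.comm (w' i) (w' j)];
  w_e : forall i j, (1 <= i <= n)%N -> (1 <= j <= n)%N ->
    w j * e i * winv j = pairing i j *: e i;
  w_f : forall i j, (1 <= i <= n)%N -> (1 <= j <= n)%N ->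
    w j * f i * winv j = (pairing i j)^-1 *: f i;
  w'_e : forall i j, (1 <= i <= n)%N -> (1 <= j <= n)%N ->
    w' j * e i * w'inv j = (pairing j i)^-1 *: e i;
  w'_f : forall i j, (1 <= i <= n)%N -> (1 <= j <= n)%N ->
    w' j * f i * w'inv j = pairing j i *: f i;
  e_f : forall i j, (1 <= i <= n)%N -> (1 <= j <= n)%N ->
    e i * f j - f j * e i =
      (if i == j then (ri i - si i)^-1 *: (w i - w' i) else 0);
  serre_e : forall i j, (1 <= i <= n)%N -> (1 <= j <= n)%N -> i != j ->
    iter `|1 - cartanB i j|%N (adl_e e w winv i) (e j) = 0;
  serre_f : forall i j, (1 <= i <= n)%N -> (1 <= j <= n)%N -> i != j ->
    iter `|1 - cartanB i j|%N (adr_f f w' w'inv i) (f j) = 0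
}.

Variable U : Urs_rep.

(* E_aux k j = E_{j-k, j} *)
Fixpoint E_aux (k j : nat) : A :=
  match k with
  | 0 => e U j
  | k'.+1 => e U (j - k) * E_aux k' j - r ^+ 2 *: (E_aux k' j * e U (j - k))
  end.
Definition Ecal (i j : nat) : A := E_aux (j - i) j.

(* Ep_aux i k = E_{i, (n-k)'} *)
Fixpoint Ep_aux (i k : nat) : A :=
  match k with
  | 0 => Ecal i n * e U n - (r * s) *: (e U n * Ecal i n)
  | k'.+1 => Ep_aux i k' * e U (n - k) - (s ^+ 2)^-1 *: (e U (n - k) * Ep_aux i k')
  end.
Definition Ecal' (i j : nat) : A := Ep_aux i (n - j).

(* F_aux k j = F_{j-k, j} *)
Fixpoint F_aux (k j : nat) : A :=
  match k with
  | 0 => f U j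
  | k'.+1 => F_aux k' j * f U (j - k) - s ^+ 2 *: (f U (j - k) * F_aux k' j)
  end.
Definition Fcal (i j : nat) : A := F_aux (j - i) j.

(* Fp_aux i k = F_{i, (n-k)'} *)
Fixpoint Fp_aux (i k : nat) : A :=
  match k with
  | 0 => f U n * Fcal i n - (r * s) *: (Fcal i n * f U n)
  | k'.+1 => f U (n - k) * Fp_aux i k' - (r ^+ 2)^-1 *: (Fp_aux i k' * f U (n - k))
  end.
Definition Fcal' (i j : nat) : A := Fp_aux i (n - j).

(* x commutes with all generators e_i, f_i, omega_i^{+-1}, omega_i'^{+-1},
   hence is central in (the image of) U. *)
Definition central_in_U (x : A) : Prop :=
  forall i, (1 <= i <= n)%N ->
    [/\ GRing.comm x (e U i), GRing.comm x (f U i),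
        GRing.comm x (w U i) & GRing.comm x (winv U i)] /\
    GRing.comm x (w' U i) /\ GRing.comm x (w'inv U i).

End UrsDefs.

(* Main.v *)
(** Call [S] annihilating for [(x, y)] when the product over [a] in [S] of the
    commuting operators [z |-> x z - a z x] kills [y]. If [S] consists of distinct
    [l]-th roots of unity, then [X^l - Y^l] is divisible by [prod (X - a Y)], so
    [x^l] commutes with [y]. It therefore suffices to find, for each root vector
    [x] and each generator [y], such a set; at most three elements are needed, and
    they are distinct because [r^4 <> s^4].

    The required q-commutation relations between root vectors come from the Serre
    relations: [u |-> u e_j - e_j (omega_j^-1 u omega_j)] is a skew derivation
    which moves each root vector [E_{k,j-1}], [E_{k,n}], [E'_{k,j+1}] to the next
    one, and applying it repeatedly to a known relation yields new ones, after
    division by [r^2 + s^2] or [r^2 + r s + s^2]. The root vectors [F] are the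
    root vectors [E] of [U_{s,r}] in the opposite algebra. *)
Require Import Defs.
From HB Require Import structures.
From mathcomp Require Import all_boot all_order all_algebra.
From mathcomp Require Import ring zify.
Import GRing.Theory.
Set Implicit Arguments. Unset Strict Implicit. Unset Printing Implicit Defensive.
Local Open Scope ring_scope.

(** * Identities in free algebras *)

Section NcExpressions.
Variables (F : fieldType) (A : algType F).

(** A root vector is an iterated bracket, and scalars of [q]-commutation multiply under brackets, so
    a relation with a given element follows from its relations with the few generators near the ends
    of the indices. What cannot be read off this way comes from the Leibniz rule. At a node below
    [n], two derivations of [uv = c vu] leave one product in each order, with coefficients that
    share the factor [r^2 + s^2] up to units. At the last node strings have length three, and three
    derivations bring in [r^2 + rs + s^2]. These factors divide [r^4 - s^4] and [r^3 - s^3], which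
    explains the two exclusions. The relations between root vectors hold for all nonzero [r], [s]
    with both factors nonzero; roots of unity enter only when powers are taken. Against [f m] the
    first scalar is always [1]: the commutator is then zero or a lower root vector times [w m] or
    [w' m], up to a scalar, and the next scalars come from the relations among the [E]. The
    exception is [E' k k.+1] against [e k] and [f k]: its last generator does not commute with
    [e k], so no recursion on the left index exists. *)

Inductive ncexpr :=
  | NcVar of nat | NcOne | NcZero | NcAdd of ncexpr & ncexpr | NcOpp of ncexpr
  | NcMul of ncexpr & ncexpr | NcScale of F & ncexpr.

Fixpoint nc_eval (env : seq A) (x : ncexpr) : A :=
  match x with
  | NcVar i => nth 0 env i
  | NcOne => 1
  | NcZero => 0
  | NcAdd x y => nc_eval env x + nc_eval env y
  | NcOpp x => - nc_eval env x
  | NcMul x y => nc_eval env x * nc_eval env y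
  | NcScale c x => c *: nc_eval env x
  end.

(** Structural copies of equality and concatenation: [ncring] unfolds exactly the constants it
    lists, so words are computed away while the coefficients in [F] stay symbolic. *)
Fixpoint nateq (m n : nat) : bool :=
  match m, n with
  | O, O => true
  | S m, S n => nateq m n
  | _, _ => false
  end.

Fixpoint wordeq (u v : seq nat) : bool :=
  match u, v with
  | [::], [::] => true
  | i :: u, j :: v => if nateq i j then wordeq u v else false
  | _, _ => false
  end.

Fixpoint wcat (u v : seq nat) : seq nat :=
  if u is i :: u then i :: wcat u v else v.

Fixpoint nc_insert (c : F) (u : seq nat) (p : seq (F * seq nat)) :=
  match p with
  | [::] => [:: (c, u)]
  | (d, v) :: p => if wordeq u v then (c + d, v) :: p else (d, v) :: nc_insert c u p
  end.

Fixpoint nc_addm (c : F) (u : seq nat) (p q : seq (F * seq nat)) :=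
  if p is (d, v) :: p then nc_insert (c * d) (wcat u v) (nc_addm c u p q) else q.

Fixpoint nc_mul (p q : seq (F * seq nat)) :=
  if p is (c, u) :: p then nc_addm c u q (nc_mul p q) else [::].

Fixpoint nc_norm (x : ncexpr) : seq (F * seq nat) :=
  match x with
  | NcVar i => [:: (1, [:: i])]
  | NcOne => [:: (1, [::])]
  | NcZero => [::]
  | NcAdd x y => nc_addm 1 [::] (nc_norm x) (nc_norm y)
  | NcOpp x => nc_addm (-1) [::] (nc_norm x) [::]
  | NcMul x y => nc_mul (nc_norm x) (nc_norm y)
  | NcScale c x => nc_addm c [::] (nc_norm x) [::]
  end.

Fixpoint nc_null (p : seq (F * seq nat)) : Prop :=
  match p with
  | [::] => True
  | (c, _) :: p => c = 0 /\ nc_null p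
  end.

Fixpoint word_eval (env : seq A) (u : seq nat) : A :=
  if u is i :: u then nth 0 env i * word_eval env u else 1.

Fixpoint poly_eval (env : seq A) (p : seq (F * seq nat)) : A :=
  if p is (c, u) :: p then c *: word_eval env u + poly_eval env p else 0.

Lemma nateqP m n : nateq m n -> m = n.
Proof. by elim: m n => [|m IH] [|n] //= /IH ->. Qed.

Lemma wordeqP u v : wordeq u v -> u = v.
Proof.
elim: u v => [|i u IH] [|j v] //=.
by case: ifP => // /nateqP -> /IH ->.
Qed.

Lemma word_eval_cat env u v :
  word_eval env (wcat u v) = word_eval env u * word_eval env v.
Proof. by elim: u => [|i u IH] /=; rewrite ?mul1r // IH mulrA. Qed.

Lemma poly_eval_insert env c u p :
  poly_eval env (nc_insert c u p) = c *: word_eval env u + poly_eval env p.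
Proof.
elim: p => [|[d v] p IH] //=.
by case: ifP => [/wordeqP -> | _] /=; rewrite ?scalerDl -?addrA // IH addrCA.
Qed.

Lemma poly_eval_addm env c u p q :
  poly_eval env (nc_addm c u p q)
  = c *: (word_eval env u * poly_eval env p) + poly_eval env q.
Proof.
elim: p => [|[d v] p IH] /=; first by rewrite mulr0 scaler0 add0r.
rewrite poly_eval_insert IH word_eval_cat mulrDr scalerDr -addrA.
by rewrite -scalerAr scalerA.
Qed.

Lemma poly_eval_mul env p q :
  poly_eval env (nc_mul p q) = poly_eval env p * poly_eval env q.
Proof.
elim: p => [|[c u] p IH] /=; first by rewrite mul0r.
by rewrite poly_eval_addm IH mulrDl scalerAl.
Qed.

Lemma poly_eval_norm env x : poly_eval env (nc_norm x) = nc_eval env x.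
Proof.
elim: x => [i|||x IHx y IHy|x IHx|x IHx y IHy|c x IHx] //=.
- by rewrite mulr1 scale1r addr0.
- by rewrite scale1r addr0.
- by rewrite poly_eval_addm IHx IHy mul1r scale1r.
- by rewrite poly_eval_addm IHx mul1r scaleN1r addr0.
- by rewrite poly_eval_mul IHx IHy.
- by rewrite poly_eval_addm IHx mul1r addr0.
Qed.

Lemma nc_null_eval env p : nc_null p -> poly_eval env p = 0.
Proof. by elim: p => [|[c u] p IH] //= [-> /IH ->]; rewrite scale0r addr0. Qed.

Lemma nc_eqP env x y :
  nc_null (nc_norm (NcAdd x (NcOpp y))) -> nc_eval env x = nc_eval env y.
Proof.
by move/(nc_null_eval env); rewrite poly_eval_norm /= => /subr0_eq.
Qed.

End NcExpressions.

Ltac nc_index x l :=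
  lazymatch l with
  | x :: _ => constr:(O)
  | _ :: ?l => let i := nc_index x l in constr:(S i)
  end.
Ltac nc_mem x l :=
  lazymatch l with
  | [::] => constr:(false)
  | x :: _ => constr:(true)
  | _ :: ?l => nc_mem x l
  end.
Ltac nc_atoms t l :=
  lazymatch t with
  | ?x + ?y => let l := nc_atoms x l in nc_atoms y l
  | - ?x => nc_atoms x l
  | ?x * ?y => let l := nc_atoms x l in nc_atoms y l
  | _ *: ?x => nc_atoms x l
  | 0 => l
  | 1 => l
  | _ => let b := nc_mem t l in
         lazymatch b with true => l | false => constr:(t :: l) end
  end.
Ltac nc_reify F t l :=
  lazymatch t with
  | ?x + ?y => let x := nc_reify F x l in let y := nc_reify F y l in
               constr:(@NcAdd F x y)
  | - ?x => let x := nc_reify F x l in constr:(@NcOpp F x)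
  | ?x * ?y => let x := nc_reify F x l in let y := nc_reify F y l in
               constr:(@NcMul F x y)
  | ?c *: ?x => let x := nc_reify F x l in constr:(@NcScale F c x)
  | 0 => constr:(@NcZero F)
  | 1 => constr:(@NcOne F)
  | _ => let i := nc_index t l in constr:(@NcVar F i)
  end.
(* Decides identities in the free algebra, up to identities between the
   coefficients, which are left as goals. *)
Ltac ncring F A :=
  lazymatch goal with
  | |- ?x = ?y =>
    let l := nc_atoms x (@nil A) in
    let l := nc_atoms y l in
    let ex := nc_reify F x l in
    let ey := nc_reify F y l in
    apply: (@nc_eqP F A l ex ey);
    lazy [nc_norm nc_mul nc_addm nc_insert nc_null wcat wordeq nateq];
    repeat (split; [|]); try exact: I
  end.

(** * q-commutators and powers *)

Section QComm.
Variables (F : fieldType) (A : algType F).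
Implicit Types (a b c t : F) (x y z u v : A) (S : seq F).

(** Here [t] is a certificate: a combination of known relations that equals the difference already
    in the free algebra. [ncring] checks the first premise, and the relations give the second. *)
Lemma eq_of_sub (x y t : A) : x - y = t -> t = 0 -> x = y.
Proof. by move=> <- /subr0_eq. Qed.

Definition qc c x y := x * y = c *: (y * x).
Definition br t x y := x * y - t *: (y * x).

Lemma qc1P x y : qc 1 x y <-> GRing.comm x y.
Proof. by rewrite /qc scale1r. Qed.

Lemma qc_br0 c x y : qc c x y <-> br c x y = 0.
Proof. by rewrite /qc /br; split=> [-> | /subr0_eq]; rewrite ?subrr. Qed.

Lemma qc_sym c x y : c != 0 -> qc c^-1 y x -> qc c x y.
Proof. by move=> c0 H; rewrite /qc H scalerA divff // scale1r. Qed.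

Lemma qc1_sym x y : qc 1 y x -> qc 1 x y.
Proof. by move=> /qc1P H; apply/qc1P. Qed.

Lemma qcMl c d x y z : qc c x z -> qc d y z -> qc (c * d) (x * y) z.
Proof.
rewrite /qc => Hx Hy.
apply: (eq_of_sub (t := x * (y * z - d *: (z * y)) + d *: ((x * z - c *: (z * x)) * y))).
  by ncring F A; ring.
by rewrite Hx Hy !subrr mulr0 mul0r scaler0 addr0.
Qed.

Lemma qcZl c t x z : qc c x z -> qc c (t *: x) z.
Proof. by move=> Hx; rewrite /qc -scalerAl Hx -scalerAr !scalerA mulrC. Qed.

Lemma qcDl c x y z : qc c x z -> qc c y z -> qc c (x + y) z.
Proof. by move=> Hx Hy; rewrite /qc mulrDl Hx Hy -scalerDr mulrDr. Qed.

Lemma qcNl c x z : qc c x z -> qc c (- x) z.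
Proof. by rewrite -scaleN1r; apply: qcZl. Qed.

Lemma qcMr c d x y z : qc c z x -> qc d z y -> qc (c * d) z (x * y).
Proof.
rewrite /qc => Hx Hy.
apply: (eq_of_sub (t := (z * x - c *: (x * z)) * y + c *: (x * (z * y - d *: (y * z))))).
  by ncring F A; ring.
by rewrite Hx Hy !subrr mulr0 mul0r scaler0 addr0.
Qed.

Lemma qcZr c t x z : qc c z x -> qc c z (t *: x).
Proof. by move=> Hx; rewrite /qc -scalerAr Hx -scalerAl !scalerA mulrC. Qed.

Lemma qcDr c x y z : qc c z x -> qc c z y -> qc c z (x + y).
Proof. by move=> Hx Hy; rewrite /qc mulrDr Hx Hy -scalerDr mulrDl. Qed.

Lemma qcNr c x z : qc c z x -> qc c z (- x).
Proof. by rewrite -scaleN1r; apply: qcZr. Qed.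

Lemma qc_brl k c d t x y z :
  k = c * d -> qc c x z -> qc d y z -> qc k (br t x y) z.
Proof.
move=> -> Hx Hy; apply: qcDl; first exact: qcMl.
by apply: qcNl; apply: qcZl; rewrite mulrC; apply: qcMl.
Qed.

Lemma qc_brr k c d t x y z :
  k = c * d -> qc c z x -> qc d z y -> qc k z (br t x y).
Proof.
move=> -> Hx Hy; apply: qcDr; first exact: qcMr.
by apply: qcNr; apply: qcZr; rewrite mulrC; apply: qcMr.
Qed.

Lemma br_swap c x y : c != 0 -> br c^-1 y x = - c^-1 *: br c x y.
Proof.
move=> c0; rewrite /br; ncring F A; field; done.
Qed.

(** Allows a recursion that adjoins generators at one end of a root vector to be exchanged for one
    at the other end. *)
Lemma br_assoc a b x y z : qc 1 x z -> br a x (br b y z) = br b (br a x y) z.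
Proof.
rewrite /qc /br scale1r => H.
apply: (eq_of_sub (t := a *: (y * (x * z - z * x)) - b *: ((x * z - z * x) * y))).
  by ncring F A; ring.
by rewrite H subrr mulr0 mul0r !scaler0 subrr.
Qed.

Lemma br1_br t x y z : br 1 (br t x y) z = br t (br 1 x z) y + br t x (br 1 y z).
Proof. by rewrite /br; ncring F A; ring. Qed.

Lemma brZl a t x y : br t (a *: x) y = a *: br t x y.
Proof. by rewrite /br; ncring F A; ring. Qed.
Lemma brZr a t x y : br t x (a *: y) = a *: br t x y.
Proof. by rewrite /br; ncring F A; ring. Qed.
Lemma brBl t x y z : br t (x - y) z = br t x z - br t y z.
Proof. by rewrite /br; ncring F A; ring. Qed.
Lemma brBr t x y z : br t x (y - z) = br t x y - br t x z.
Proof. by rewrite /br; ncring F A; ring. Qed.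
Lemma br0r t x : br t x 0 = 0.
Proof. by rewrite /br mulr0 mul0r scaler0 subrr. Qed.
Lemma br0l t x : br t 0 x = 0.
Proof. by rewrite /br mulr0 mul0r scaler0 subrr. Qed.

(* [ann S x y]: the product over [a] in [S] of the commuting operators
   [z |-> x z - a z x] kills [y]. *)
Fixpoint ann S x y : Prop :=
  if S is a :: S' then ann S' x (br a x y) else y = 0.

Lemma annZ S x c y : ann S x y -> ann S x (c *: y).
Proof.
elim: S y => [|a S IH] y /=; first by move=> ->; rewrite scaler0.
by move/IH; rewrite brZr.
Qed.

Lemma ann_qc c x y : qc c x y -> ann [:: c] x y.
Proof. by move/qc_br0. Qed.

Lemma ann_cons c t S x y z : br c x y = t *: z -> ann S x z -> ann (c :: S) x y.
Proof. by move=> /= -> /annZ; apply. Qed.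

Lemma annC a b S x y : ann [:: a, b & S] x y -> ann [:: b, a & S] x y.
Proof.
have -> // : ann [:: b, a & S] x y = ann [:: a, b & S] x y.
by rewrite /=; congr (ann S x _); rewrite /br; ncring F A; ring.
Qed.

Lemma ann_mulr S x y z c : ann S x y -> qc c x z -> ann [seq c * a | a <- S] x (y * z).
Proof.
move=> + H; elim: S y => [|a S IH] y /=; first by move=> ->; rewrite mul0r.
move/IH; suff -> : br (c * a) x (y * z) = br a x y * z by [].
apply: (eq_of_sub (t := a *: (y * (x * z - c *: (z * x))))).
  by rewrite /br; ncring F A; ring.
by rewrite H subrr mulr0 scaler0.
Qed.

Lemma ann_mull S x y z c : ann S x y -> qc c x z -> ann [seq c * a | a <- S] x (z * y).
Proof.
move=> + H; elim: S y => [|a S IH] y /=; first by move=> ->; rewrite mulr0.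
move=> /IH /(annZ c); suff -> : br (c * a) x (z * y) = c *: (z * br a x y) by [].
apply: (eq_of_sub (t := (x * z - c *: (z * x)) * y)).
  by rewrite /br; ncring F A; ring.
by rewrite H subrr mul0r.
Qed.

(** Reversing a bracket inverts its scalar and costs only a nonzero factor. A Serre relation for [y]
    acting on [x] thus becomes a relation of the root vector [br c x y] with [y]. *)
Lemma ann2_br c d x y : c != 0 -> d != 0 ->
  ann [:: c^-1; d^-1] y x -> qc d (br c x y) y.
Proof.
move=> c0 d0 /=; rewrite (br_swap x y c0) brZr br_swap // scalerA => /eqP.
by rewrite scaler_eq0 mulf_eq0 !oppr_eq0 !invr_eq0 (negPf c0) (negPf d0) => /eqP /qc_br0.
Qed.

Lemma ann3_br c d k x y : c != 0 -> d != 0 -> k != 0 ->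
  ann [:: c^-1; d^-1; k^-1] y x -> qc k (br d (br c x y) y) y.
Proof.
move=> c0 d0 k0 /=; rewrite (br_swap x y c0) brZr (br_swap _ y d0) !brZr br_swap // !scalerA.
move=> /eqP; rewrite scaler_eq0 !mulf_eq0 !oppr_eq0 !invr_eq0.
by rewrite (negPf c0) (negPf d0) (negPf k0) => /eqP /qc_br0.
Qed.

Lemma annD S x y z : ann S x y -> ann S x z -> ann S x (y + z).
Proof.
elim: S y z => [|a S IH] y z /=; first by move=> -> ->; rewrite addr0.
move=> Hy Hz; have := IH _ _ Hy Hz; congr (ann S x _).
by rewrite /br; ncring F A; ring.
Qed.

Lemma ann_brr S S' c t x y z : S' = [seq c * a | a <- S] ->
  ann S x y -> qc c x z -> ann S' x (br t z y).
Proof.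
move=> -> Hy Hz; rewrite /br -scaleNr; apply: annD; first exact: ann_mull.
by apply: annZ; apply: ann_mulr.
Qed.

Lemma map_mul1 S : S = [seq 1 * a | a <- S].
Proof. by elim: S => //= a S {1}->; rewrite mul1r. Qed.

(** The degree [m] homogenization of [p], evaluated at left and right multiplication by [x] and
    applied to [y]. These two operators commute, so polynomial identities carry over. *)
Definition hom_eval x y m (p : {poly F}) : A :=
  \sum_(i < m.+1) p`_i *: (x ^+ i * y * x ^+ (m - i)).

Lemma hom_evalM a x y m (p : {poly F}) : (size p <= m.+1)%N ->
  hom_eval x y m.+1 (p * ('X - a%:P)) = hom_eval x (br a x y) m p.
Proof.
move=> sp; rewrite /hom_eval.
under eq_bigr => i _ do rewrite mulrBr coefB coefMX coefMC scalerBl.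
rewrite sumrB big_ord_recl /= scale0r add0r [X in _ - X]big_ord_recr /=.
rewrite [p`_m.+1]nth_default // mul0r scale0r addr0 -sumrB.
apply: eq_bigr => i _; rewrite /bump /= add1n subSS.
have -> : (m.+1 - i = (m - i).+1)%N by rewrite subSn // -ltnS.
rewrite exprSr exprS /br.
set X := x ^+ i; set Y := x ^+ (m - i).
by ncring F A; ring.
Qed.

(** Each linear factor is moved from the polynomial onto [y] and lowers the degree; after the last
    one the argument is zero. [q != 0] excludes degree [0] while factors remain. *)
Lemma ann_hom_eval S x y m (q : {poly F}) : ann S x y -> q != 0 ->
  (size q + size S <= m.+1)%N -> hom_eval x y m (q * \prod_(a <- S) ('X - a%:P)) = 0.
Proof.
elim: S y m q => [|a S IH] y m q /=.
  by move=> -> _ _; rewrite /hom_eval big1 // => i _; rewrite mulr0 mul0r scaler0.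
move=> HS q0; case: m => [|m]; rewrite addnS !ltnS => sz.
  by rewrite leqn0 addn_eq0 size_poly_eq0 (negPf q0) in sz.
rewrite big_cons mulrCA mulrC hom_evalM; first exact: IH.
rewrite size_proper_mul ?size_prod_XsubC; last first.
  by rewrite mulf_neq0 ?lead_coef_eq0 // monic_neq0 // monic_prod_XsubC.
by rewrite addnS.
Qed.

(* X^l - Y^l is divisible by the homogeneous polynomial prod (X - aY). *)
Lemma ann_expr_comm S l x y : (0 < l)%N -> uniq S -> all (fun a => a ^+ l == 1) S ->
  ann S x y -> GRing.comm (x ^+ l) y.
Proof.
move=> l0 uS rS HS.
have p0 : 'X^l - 1 != 0 :> {poly F} by rewrite -size_poly_eq0 size_XnsubC.
have /dvdpP [q Hq] : \prod_(a <- S) ('X - a%:P) %| ('X^l - 1 : {poly F}).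
  rewrite uniq_roots_dvdp ?uniq_rootsE //.
  by apply: sub_all rS => a /eqP al; rewrite /root !hornerE al subrr.
have q0 : q != 0 by apply: contraNneq p0 => q0; rewrite Hq q0 mul0r.
have sq : (size q + size S <= l.+1)%N.
  have := size_XnsubC (1 : F) l0; rewrite Hq size_Mmonic ?monic_prod_XsubC //.
  by rewrite size_prod_XsubC addnS /= => ->.
have := ann_hom_eval HS q0 sq; rewrite -Hq /hom_eval.
(* For ['X^l - 1] only the two end terms survive, [x ^+ l * y] and [y * x ^+ l]. *)
under eq_bigr => i _ do rewrite coefB coefXn coef1 scalerBl.
rewrite sumrB (bigD1 ord_max) //= eqxx scale1r subnn mulr1 big1 ?addr0; last first.
  move=> i /eqP ni; case: eqP => [e|]; last by rewrite scale0r.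
  by case: ni; apply: val_inj.
rewrite (bigD1 ord0) //= scale1r subn0 mul1r big1 ?addr0; last first.
  by move=> i /eqP ni; case: eqP => [e|]; [case: ni; apply: val_inj | rewrite scale0r].
by move=> /subr0_eq.
Qed.

End QComm.

(** * Strings under a skew derivation *)

Section Strings.
Variables (F : fieldType) (A : algType F).
Implicit Types (x y e u v f : A).

Lemma eq_of_scale (k : F) x y t : k != 0 -> k *: (x - y) = t -> t = 0 -> x = y.
Proof.
move=> k0 <- /eqP; rewrite scaler_eq0 (negPf k0) /= => /eqP.
exact: subr0_eq.
Qed.

(* In the next lemmas [x |-> br a x e], for [a] the weight of [x], is a skew
   derivation, and the conclusion is obtained by applying it to the hypothesis. *)
Lemma string2 e u v (a b a2 b2 c k : F) : b * a2 = a * b2 -> a2 + b2 != 0 ->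
  k * (a2 + b2) = c * (a + b) ->
  qc b (br a u e) e -> qc b2 (br a2 v e) e ->
  qc c u v -> qc k (br a u e) (br a2 v e).
Proof.
move=> ab n0 kE /qc_br0 Du /qc_br0 Dv /qc_br0 R; rewrite /qc.
apply: (scalerI n0); rewrite scalerA mulrC kE.
(* Writing [D] for the derivation, [D^2] of [u * v] is [(a2 + b2) *: (Du * Dv)] up to terms in
   [D^2 u] or [D^2 v], which vanish. The hypothesis [ab] makes the weights of the two summands of
   [D (u * v)] agree. *)
apply: (eq_of_sub (t := br (a * b2) (br (a * a2) (br c u v) e) e
  - u * br b2 (br a2 v e) e - (a2 * a2) *: (br b (br a u e) e * v)
  + c *: (v * br b (br a u e) e) + (c * a * a) *: (br b2 (br a2 v e) e * u))).
  by rewrite /br; ncring F A; ring: ab.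
by rewrite R Du Dv !br0l !(mulr0, mul0r, scaler0, subr0, addr0).
Qed.

(** [string2] relates [br a u e] to [br b^-1 f e]; moving [e] past the former turns this into a
    commutator with [e]. For consecutive nodes it shows that a root vector commutes with an interior
    generator. *)
Lemma string2_middle e u f (a b : F) : a != 0 -> b != 0 -> a + b != 0 ->
  qc b (br a u e) e -> qc a^-1 (br b^-1 f e) e -> qc 1 u f ->
  qc 1 (br a (br a u e) f) e.
Proof.
move=> a0 b0 n0 Hu Hf uf.
have ab1 : b^-1 + a^-1 != 0.
  have -> : b^-1 + a^-1 = (a + b) / (a * b) by field; rewrite a0 b0.
  by rewrite mulf_neq0 ?invr_neq0 ?mulf_neq0.
have H : qc (a * b) (br a u e) (br b^-1 f e).
  by apply: (string2 _ ab1 _ Hu Hf uf); field; rewrite ?a0 ?b0.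
move/qc_br0: H => H; move/qc_br0: Hu => Hu; rewrite /qc.
apply: (eq_of_sub (t := br (a * b) (br a u e) (br b^-1 f e)
  + b^-1 *: (br b (br a u e) e * f) - a *: (f * br b (br a u e) e))).
  by rewrite /br; ncring F A; field; rewrite ?a0 ?b0.
by rewrite H Hu !(mulr0, mul0r, scaler0, subr0, addr0).
Qed.

Variables (r s : F).
Hypotheses (r0 : r != 0) (s0 : s != 0).

(** The weights along the string are [r^2], [rs], [s^2]. Two derivations of the relation of [x] with
    [y] leave [rs] times the relation of [y] with [z]. *)
Lemma string3_self e x (y := br (r ^+ 2) x e) (z := br (r * s) y e) :
  qc (s ^+ 2) z e -> qc (s ^+ 2) x y -> qc (s ^+ 2) y z.
Proof.
move=> /qc_br0 Dz /qc_br0 R; rewrite /qc.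
have rs0 : r * s != 0 by rewrite mulf_neq0.
apply: (eq_of_scale rs0 (t := br (r ^+ 2 * s ^+ 2) (br (r ^+ 3 * s) (br (s ^+ 2) x y) e) e
  - x * br (s ^+ 2) z e + (r ^+ 4 * s ^+ 2) *: (br (s ^+ 2) z e * x))).
  by rewrite /z /y /br; ncring F A; ring.
by rewrite Dz R !br0l !(mulr0, mul0r, scaler0, subr0, addr0).
Qed.

Section Pair.
Variables e x x' : A.
Let y := br (r ^+ 2) x e.
Let z := br (r * s) y e.
Let y' := br (r ^+ 2) x' e.
Let z' := br (r * s) y' e.
Hypotheses (Dz : qc (s ^+ 2) z e) (Dz' : qc (s ^+ 2) z' e).
Hypotheses (xx' : qc (s ^+ 2) x x') (yx' : qc 1 y x').
Hypothesis h3 : r ^+ 2 + r * s + s ^+ 2 != 0.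

(** Let [N = r^2 + rs + s^2]. Three derivations of [x x' - s^2 x' x] give [N (y z' + r^2 z y' - s^2
    y' z - r^2 s^2 z' y)]. Subtracting [N] times the second derivative of [y x' - x' y] cancels
    [y z'] and [z' y] and leaves [- rs N (z y' - y' z)]. *)
Lemma string3_zy : qc 1 z y'.
Proof.
move/qc_br0: xx' => R; move/qc_br0: yx' => Q.
move/qc_br0: Dz => D; move/qc_br0: Dz' => D'; rewrite /qc.
have k0 : - (r * s * (r ^+ 2 + r * s + s ^+ 2)) != 0.
  by rewrite oppr_eq0 !mulf_neq0.
apply: (eq_of_scale k0 (t :=
  br (r ^+ 2 * s ^+ 2) (br (r ^+ 3 * s)
       (br (r ^+ 4) (br (s ^+ 2) x x') e - r ^+ 2 *: br 1 y x') e) e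
  - (s ^+ 2 + r * s) *: br (r ^+ 2 * s ^+ 2) (br (r ^+ 3 * s) (br 1 y x') e) e
  - (x * br (s ^+ 2) z' e - (r ^+ 6 * s ^+ 2) *: (br (s ^+ 2) z' e * x)
     - (s ^+ 2 - r ^+ 2) *: (x' * br (s ^+ 2) z e))
  + (s ^+ 2 + r * s) *: (r ^+ 4 *: (br (s ^+ 2) z e * x') - x' * br (s ^+ 2) z e))).
  by rewrite /z /z' /y /y' /br; ncring F A; ring.
by rewrite D D' R Q !(br0l, mulr0, mul0r, scaler0, subr0, addr0).
Qed.

Lemma string3_zz : qc (s ^+ 2) z z'.
Proof.
move/qc_br0: string3_zy => R.
move/qc_br0: Dz => D; move/qc_br0: Dz' => D'; rewrite /qc.
apply: (eq_of_sub (t := br (r * s ^+ 3) (br 1 z y') e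
  - (r * s) *: (br (s ^+ 2) z e * y') + y' * br (s ^+ 2) z e)).
  by rewrite /z' /br; ncring F A; ring.
by rewrite D R !(br0l, mulr0, mul0r, scaler0, subr0, addr0).
Qed.

(** Expand [y'] in [z y' = y' z], move [e] past [z], and regroup. *)
Lemma string3_tail : qc (r ^+ 2 * s ^+ 2) (br (s ^+ 2)^-1 z x') e.
Proof.
move/qc_br0: string3_zy => R; move/qc_br0: Dz => D; rewrite /qc.
apply: (eq_of_sub (t := br 1 z y' - (s ^+ 2)^-1 *: (x' * br (s ^+ 2) z e)
  + r ^+ 2 *: (br (s ^+ 2) z e * x'))).
  by rewrite /y' /br; ncring F A; field; done.
by rewrite D R !(br0l, mulr0, mul0r, scaler0, subr0, addr0).
Qed.
End Pair.
End Strings.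

(* [lia] preprocesses every boolean hypothesis, and those over the field slow it
   down considerably. *)
Ltac idx :=
  try match goal with K : fieldType |- _ =>
    repeat match goal with H : context [K] |- _ => clear H end end;
  lia.

(** * Root vectors *)

Section QcSides.
Variables (F : fieldType) (A : algType F).
Definition qcl (z : A) c x := qc c x z.
Definition qcr (z : A) c x := qc c z x.

Lemma qcl_br (z : A) k c d t x y :
  k = c * d -> qcl z c x -> qcl z d y -> qcl z k (br t x y).
Proof. exact: qc_brl. Qed.

Lemma qcr_br (z : A) k c d t x y :
  k = c * d -> qcr z c x -> qcr z d y -> qcr z k (br t x y).
Proof. exact: qc_brr. Qed.

End QcSides.

Section RootVectors.
Variables (F : fieldType) (r s : F) (n : nat) (A : algType F).
Variable U : Urs_rep r s n A.
Hypotheses (r0 : r != 0) (s0 : s != 0).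

Local Notation e := (e U).
Local Notation f := (f U).
Local Notation w := (w U).
Local Notation w' := (w' U).
Local Notation E := (Ecal U).
Local Notation E' := (Ecal' U).
Local Notation p := (pairing r s n).

(** * Values of the pairing, and Serre relations as annihilating sets *)

Lemma pairing_diag i : (i < n)%N -> p i i = r ^+ 2 / s ^+ 2.
Proof. by move=> lt_in; rewrite /pairing eqxx lt_in. Qed.

Lemma pairing_last : p n n = r / s.
Proof. by rewrite /pairing eqxx ltnn. Qed.

Lemma pairing_up i : (i < n)%N -> p i i.+1 = (r ^+ 2)^-1.
Proof. by move=> lt_in; rewrite /pairing; do 3 (case: ifP => //; try idx). Qed.

Lemma pairing_down i : (i < n)%N -> p i.+1 i = s ^+ 2.
Proof.
by move=> lt_in; rewrite /pairing; do 3 (case: ifP => //; try idx).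
Qed.

Lemma pairing_far i j : (i.+1 < j)%N || (j.+1 < i)%N -> p i j = 1.
Proof.
by move=> ij; rewrite /pairing; do 3 (case: ifP => //; try idx).
Qed.

Lemma pairing_neq0 i j : p i j != 0.
Proof.
by rewrite /pairing; do !case: ifP => _;
  rewrite ?oner_neq0 ?mulf_neq0 ?invr_neq0 ?expf_neq0.
Qed.

Lemma qc_conj (x y yi : A) c : c != 0 -> yi * y = 1 ->
  y * x * yi = c *: x -> qc c^-1 x y.
Proof.
move=> c0 H1 H; rewrite /qc; apply: (scalerI c0).
by rewrite scalerAl -H -[_ * yi * y]mulrA H1 mulr1 scalerA divff // scale1r.
Qed.

Lemma e_w i j : (1 <= i <= n)%N -> (1 <= j <= n)%N -> qc (p i j)^-1 (e i) (w j).
Proof.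
move=> Hi Hj; have [_ Hw] := w_inv U Hj.
exact: (qc_conj (pairing_neq0 i j) Hw (w_e U Hi Hj)).
Qed.

Lemma e_w' i j : (1 <= i <= n)%N -> (1 <= j <= n)%N -> qc (p j i) (e i) (w' j).
Proof.
move=> Hi Hj; have [_ Hw] := w'_inv U Hj.
have H := qc_conj _ Hw (w'_e U Hi Hj).
by rewrite -[p j i]invrK; apply: H; rewrite invr_eq0 pairing_neq0.
Qed.

(** On a weight vector the adjoint action is a bracket, so an iterated adjoint action is an
    annihilating set; by [w_br] each step multiplies the scalar by [p i i]. *)
Lemma adl_br i y c : w i * y * winv U i = c *: y ->
  adl_e e w (winv U) i y = br c (e i) y.
Proof. by move=> H; rewrite /adl_e H -scalerAl. Qed.

Lemma w_br i y c : (1 <= i <= n)%N -> w i * y * winv U i = c *: y ->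
  w i * br c (e i) y * winv U i = (p i i * c) *: br c (e i) y.
Proof.
move=> Hi Hy; have [_ Hw] := w_inv U Hi; have He := w_e U Hi Hi.
have conjM a b : w i * (a * b) * winv U i = (w i * a * winv U i) * (w i * b * winv U i).
  by rewrite !mulrA -[_ * winv U i * w i]mulrA Hw mulr1.
rewrite /br mulrBr mulrBl -scalerAr -scalerAl !conjM He Hy.
by ncring F A; ring.
Qed.

Lemma serre1 i j : (1 <= i <= n)%N -> (1 <= j <= n)%N ->
  (i.+1 < j)%N || (j.+1 < i)%N -> qc 1 (e i) (e j).
Proof.
move=> Hi Hj Hij.
have nij : i != j by idx.
have cE : cartanB n i j = 0.
  by rewrite /cartanB; do !(case: ifP => [|_]; first idx).
have := serre_e U Hi Hj nij; rewrite cE /= (@adl_br _ _ 1); first by move/qc_br0.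
by rewrite w_e // pairing_far // orbC.
Qed.

Lemma serre2 i j : (1 <= i <= n)%N -> (1 <= j <= n)%N -> i != j ->
  cartanB n i j = -1 -> ann [:: p j i; p i i * p j i] (e i) (e j).
Proof.
move=> Hi Hj nij cE.
have := serre_e U Hi Hj nij; rewrite cE /=.
have H1 := w_e U Hj Hi.
by rewrite (adl_br H1) (adl_br (w_br Hi H1)).
Qed.

Lemma serre3 i j : (1 <= i <= n)%N -> (1 <= j <= n)%N -> i != j ->
  cartanB n i j = -2 ->
  ann [:: p j i; p i i * p j i; p i i * (p i i * p j i)] (e i) (e j).
Proof.
move=> Hi Hj nij cE.
have := serre_e U Hi Hj nij; rewrite cE /=.
have H1 := w_e U Hj Hi; have H2 := w_br Hi H1.
by rewrite (adl_br H1) (adl_br H2) (adl_br (w_br Hi H2)).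
Qed.

Lemma serre_up i : (0 < i < n)%N -> ann [:: s ^+ 2; r ^+ 2] (e i) (e i.+1).
Proof.
move=> Hi; have := @serre2 i i.+1.
rewrite pairing_down ?pairing_diag; [|idx..].
have -> : r ^+ 2 / s ^+ 2 * s ^+ 2 = r ^+ 2 by field.
by apply; try idx; rewrite /cartanB; do 4 (case: ifP => //; try idx).
Qed.

Lemma serre_down i : (0 < i)%N -> (i.+1 < n)%N ->
  ann [:: (r ^+ 2)^-1; (s ^+ 2)^-1] (e i.+1) (e i).
Proof.
move=> Hi Hn; have := @serre2 i.+1 i.
rewrite pairing_up ?pairing_diag; [|idx..].
have -> : r ^+ 2 / s ^+ 2 * (r ^+ 2)^-1 = (s ^+ 2)^-1 by field; rewrite r0 s0.
by apply; try idx; rewrite /cartanB; do 4 (case: ifP => //; try idx).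
Qed.

Lemma serre_last i : (0 < i)%N -> i.+1 = n ->
  ann [:: (r ^+ 2)^-1; (r * s)^-1; (s ^+ 2)^-1] (e n) (e i).
Proof.
move=> Hi Hn; have := @serre3 n i.
have -> : p i n = (r ^+ 2)^-1 by have := @pairing_up i; rewrite Hn; apply; idx.
rewrite pairing_last.
have -> : r / s * (r ^+ 2)^-1 = (r * s)^-1 by field; rewrite r0 s0.
have -> : r / s * (r * s)^-1 = (s ^+ 2)^-1 by field; rewrite r0 s0.
by apply; try idx; rewrite /cartanB; do 4 (case: ifP => //; try idx).
Qed.

(** * Recursions for the root vectors, and propagation of weights along them *)

Lemma Ecal_id k : E k k = e k.
Proof. by rewrite /Ecal subnn. Qed.

Lemma Ecal_l k j : (k < j)%N -> E k j = br (r ^+ 2) (e k) (E k.+1 j).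
Proof.
move=> kj; rewrite /Ecal; have -> : (j - k = (j - k.+1).+1)%N by idx.
rewrite /=; have -> // : (j - (j - k.+1).+1 = k)%N by idx.
Qed.

Lemma Ecal_r k j : (1 <= k <= j)%N -> (j < n)%N ->
  E k j.+1 = br (r ^+ 2) (E k j) (e j.+1).
Proof.
move Dm: (j - k)%N => m; elim: m k Dm => [|m IH] k Dm Hk Hj.
  have -> : k = j by idx.
  by rewrite Ecal_l // !Ecal_id.
rewrite Ecal_l; last idx.
rewrite IH //; try idx.
rewrite br_assoc -?Ecal_l //; first idx.
apply: serre1; idx.
Qed.

Lemma Ecal'_n k : E' k n = br (r * s) (E k n) (e n).
Proof. by rewrite /Ecal' subnn. Qed.

Lemma Ecal'_S k j : (j < n)%N -> E' k j = br (s ^+ 2)^-1 (E' k j.+1) (e j).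
Proof.
move=> jn; rewrite /Ecal'; have -> : (n - j = (n - j.+1).+1)%N by idx.
rewrite /=; have -> // : (n - (n - j.+1).+1 = j)%N by idx.
Qed.

(** The strict gap makes [e k] commute with every generator from [e n] down to [e j], as [br_assoc]
    requires. *)
Lemma Ecal'_l k j : (1 <= k)%N -> (k.+1 < j <= n)%N ->
  E' k j = br (r ^+ 2) (e k) (E' k.+1 j).
Proof.
move=> k1; move Dm: (n - j)%N => m; elim: m j Dm => [|m IH] j Dm Hj.
  have -> : j = n by idx.
  rewrite !Ecal'_n Ecal_l; last idx.
  rewrite br_assoc //; apply: serre1; idx.
rewrite [LHS]Ecal'_S; last idx.
rewrite IH; [|idx..].
rewrite -br_assoc -?Ecal'_S //; first idx.
apply: serre1; idx.
Qed.

Section Closure.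
(** To be read as: the vector has weight [c]. Instances are [q]-commutation with a fixed element on
    either side, and later [semi_inv], which ignores the scalar. *)
Variable Q : F -> A -> Prop.
Hypothesis Qbr : forall k c d t x y, k = c * d -> Q c x -> Q d y -> Q k (br t x y).

Lemma Ecal_from c k m j : (1 <= k <= m)%N -> (m <= j <= n)%N ->
  Q c (E k m) -> (forall i, (m < i <= j)%N -> Q 1 (e i)) -> Q c (E k j).
Proof.
move=> Hk; elim: j => [|j IH] Hj Hm He.
  by have -> : 0%N = m by idx.
have [<- // | ne] := eqVneq m j.+1.
rewrite Ecal_r; [|idx..].
apply: (Qbr _ (c := c) (d := 1)); first by rewrite mulr1.
- by apply: IH => //; try idx; move=> i Hi; apply: He; idx.
- by apply: He; idx.
Qed.

Lemma Ecal_first c k j : (1 <= k <= j)%N -> (j <= n)%N ->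
  Q c (e k) -> (forall i, (k < i <= j)%N -> Q 1 (e i)) -> Q c (E k j).
Proof.
by move=> Hk Hj He Hi; apply: (@Ecal_from c k k) => //; rewrite ?Ecal_id //; idx.
Qed.

Lemma Ecal_all c k j : (1 <= k <= j)%N -> (j <= n)%N -> c = 1 ->
  (forall i, (k <= i <= j)%N -> Q 1 (e i)) -> Q c (E k j).
Proof.
move=> Hk Hj -> He; apply: Ecal_first => // [|i Hi]; apply: He; idx.
Qed.

Lemma Ecal_last c k j : (1 <= k <= j)%N -> (j <= n)%N ->
  Q c (e j) -> (forall i, (k <= i < j)%N -> Q 1 (e i)) -> Q c (E k j).
Proof.
move=> Hk Hj; case: j Hk Hj => [|j] Hk Hj Hc He; first idx.
have [-> | ne] := eqVneq k j.+1; first by rewrite Ecal_id.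
rewrite Ecal_r; [|idx..].
apply: (Qbr _ (c := 1) (d := c)) => //; first by rewrite mul1r.
by apply: Ecal_all => //; try idx; move=> i Hi; apply: He; idx.
Qed.

Lemma Ecal'_from c k m j : (j <= m <= n)%N ->
  Q c (E' k m) -> (forall i, (j <= i < m)%N -> Q 1 (e i)) -> Q c (E' k j).
Proof.
move Dm: (m - j)%N => d; elim: d j Dm => [|d IH] j Dm Hj Hm He.
  by have -> : j = m by idx.
rewrite Ecal'_S; last idx.
apply: (Qbr _ (c := c) (d := 1)); first by rewrite mulr1.
- by apply: IH => //; try idx; move=> i Hi; apply: He; idx.
- by apply: He; idx.
Qed.

Lemma Ecal'_fromE c d b k j : (j <= n)%N -> b = c * d ->
  Q c (E k n) -> Q d (e n) -> (forall i, (j <= i < n)%N -> Q 1 (e i)) ->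
  Q b (E' k j).
Proof.
move=> Hj -> HE Hn He; apply: (@Ecal'_from _ k n) => //; first idx.
by rewrite Ecal'_n; apply: (Qbr _ erefl HE Hn).
Qed.

End Closure.

Hypothesis h2 : r ^+ 2 + s ^+ 2 != 0.
Hypothesis h3 : r ^+ 2 + r * s + s ^+ 2 != 0.

Let r20 : r ^+ 2 != 0. Proof. by rewrite expf_neq0. Qed.
Let s20 : s ^+ 2 != 0. Proof. by rewrite expf_neq0. Qed.
Let rs0 : r * s != 0. Proof. by rewrite mulf_neq0. Qed.
Let h2V : (s ^+ 2)^-1 + (r ^+ 2)^-1 != 0.
Proof.
have -> : (s ^+ 2)^-1 + (r ^+ 2)^-1 = (r ^+ 2 + s ^+ 2) / (r ^+ 2 * s ^+ 2).
  by field; rewrite r0 s0.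
by rewrite mulf_neq0 ?invr_neq0 ?mulf_neq0.
Qed.

(** * Relations of the root vectors with the [e m] and among themselves *)

Lemma E_e_far k j m : (1 <= k <= j)%N -> (j <= n)%N -> (1 <= m <= n)%N ->
  (j.+1 < m)%N || (m.+1 < k)%N -> qc 1 (E k j) (e m).
Proof.
move=> Hk Hj Hm Hkm; apply: (Ecal_all (qcl_br (z := e m))) => // i Hi.
apply: serre1; idx.
Qed.

Lemma E_e_top k j : (1 <= k < j)%N -> (j < n)%N -> qc (s ^+ 2) (E k j) (e j).
Proof.
case: j => [|j] Hk Hj; first idx.
rewrite Ecal_r; [|idx..]; apply: ann2_br => //.
case: j Hk Hj => [|j] Hk Hj; first idx.
have [-> | ne] := eqVneq k j.+1; first by rewrite Ecal_id; apply: serre_down.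
rewrite Ecal_r; [|idx..]; apply: (ann_brr _ (map_mul1 _)).
  by apply: serre_down.
apply: qc1_sym; apply: E_e_far; idx.
Qed.

Lemma E_e_bot k j : (1 <= k < j)%N -> (j <= n)%N -> qc (s ^+ 2)^-1 (E k j) (e k).
Proof.
move=> Hk Hj; apply: (@Ecal_from _ (qcl_br (z := e k)) _ _ k.+1); try idx.
  rewrite Ecal_l // Ecal_id; apply: qc_sym; first by rewrite invr_eq0.
  rewrite invrK; apply/qc_br0.
  by apply: (annC (S := [::])); apply: serre_up => //; idx.
by move=> i Hi; apply: serre1; idx.
Qed.

(** For [j = m.+1] this is [string2_middle] on [E k m.-1], [e m], [e m.+1]; the generators adjoined
    afterwards commute with [e m]. *)
Lemma E_e_mid k m j : (1 <= k < m)%N -> (m < j <= n)%N -> qc 1 (E k j) (e m).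
Proof.
move=> Hk Hj; apply: (@Ecal_from _ (qcl_br (z := e m)) _ _ m.+1); try idx.
  case: m Hk Hj => [|m] Hk Hj; first idx.
  rewrite Ecal_r; [|idx..]; rewrite Ecal_r; [|idx..].
  apply: (@string2_middle _ _ _ _ _ _ (s ^+ 2)) => //.
  - by rewrite -Ecal_r; [apply: E_e_top|..]; idx.
  - by apply: ann2_br; rewrite ?invr_eq0 // !invrK; apply: serre_up => //; idx.
  - by apply: E_e_far; idx.
by move=> i Hi; apply: serre1; idx.
Qed.

Lemma E_last k : (1 <= k < n)%N -> E k n = br (r ^+ 2) (E k n.-1) (e n).
Proof.
by move=> Hk; have := @Ecal_r k n.-1; rewrite prednK; [apply|]; idx.
Qed.

Lemma E'_e_last k : (1 <= k < n)%N -> qc (s ^+ 2) (E' k n) (e n).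
Proof.
move=> Hk; rewrite Ecal'_n E_last //; apply: ann3_br => //.
have [En | ne] := eqVneq k n.-1.
  by rewrite -En Ecal_id; apply: serre_last; idx.
have -> : n.-1 = n.-2.+1 by idx.
rewrite Ecal_r; [|idx..]; apply: (ann_brr _ (map_mul1 _)).
  by apply: serre_last; idx.
by apply: qc1_sym; apply: E_e_far; idx.
Qed.

Lemma E'_e_low k m j : (1 <= k < m)%N -> (m.+1 < j <= n)%N -> qc 1 (E' k j) (e m).
Proof.
move=> Hk Hj.
apply: (@Ecal'_fromE _ (qcl_br (z := e m)) 1 1); rewrite ?mulr1 //; try idx.
- by apply: E_e_mid; idx.
- by apply: serre1; idx.
- by move=> i Hi; apply: serre1; idx.
Qed.

Lemma E'_e_top k j : (1 <= k < j)%N -> (j < n)%N -> qc (r ^+ 2)^-1 (E' k j) (e j).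
Proof.
move=> Hk Hj; rewrite Ecal'_S //; apply: ann2_br; rewrite ?invr_eq0 // !invrK.
have [En | ne] := eqVneq j.+1 n.
  rewrite En Ecal'_n; apply: (ann_brr _ (map_mul1 _)).
    by have := @serre_up j; rewrite En; apply; idx.
  by apply: qc1_sym; apply: E_e_mid; idx.
rewrite Ecal'_S; last idx.
apply: (ann_brr _ (map_mul1 _)); first by apply: serre_up => //; idx.
by apply: qc1_sym; apply: E'_e_low; idx.
Qed.

Lemma E'_e_above k j m : (1 <= k < j)%N -> (j < m < n)%N -> qc 1 (E' k j) (e m).
Proof.
move=> Hk Hj; apply: (@Ecal'_from _ (qcl_br (z := e m)) _ _ m.-1); try idx.
  case: m Hj => [|m] Hj; first idx.
  rewrite /qcl /= Ecal'_S ?[E' k m.+1]Ecal'_S; [|idx..].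
  apply: (@string2_middle _ _ _ _ _ _ (r ^+ 2)^-1); rewrite ?invr_eq0 //.
  - by rewrite -Ecal'_S; [apply: E'_e_top|..]; idx.
  - by rewrite !invrK; apply: ann2_br => //; apply: serre_down => //; idx.
  - by apply: E'_e_low; idx.
by move=> i Hi; apply: serre1; idx.
Qed.

Lemma EE_row k i j : (1 <= k < i)%N -> (i <= j < n)%N -> qc (s ^+ 2) (E k j) (E i j).
Proof.
move=> Hk Hj; apply: (Ecal_last (qcr_br (z := E k j))); try idx.
- by apply: E_e_top; idx.
- by move=> m Hm; apply: E_e_mid; idx.
Qed.

Lemma EE_inner k i j j' : (1 <= k < i)%N -> (i <= j < j')%N -> (j' <= n)%N ->
  qc 1 (E k j') (E i j).
Proof.
move=> Hk Hj Hj'; apply: (Ecal_all (qcr_br (z := E k j'))) => //; try idx.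
by move=> m Hm; apply: E_e_mid; idx.
Qed.

Lemma EE_column k j : (1 <= k <= j)%N -> (j < n)%N -> qc (s ^+ 2) (E k j) (E k j.+1).
Proof.
move=> Hk Hj; apply: (Ecal_first (qcl_br (z := E k j.+1))); try idx.
- by apply: qc_sym => //; apply: E_e_bot; idx.
- by move=> m Hm; apply: qc1_sym; apply: E_e_mid; idx.
Qed.

(** The two strings under [e n] start at [E k n.-1] and [E i n.-1]. *)
Lemma E'E_last k i : (1 <= k < i)%N -> (i < n)%N -> qc 1 (E' k n) (E i n).
Proof.
move=> Hk Hi; rewrite Ecal'_n !E_last; [|idx..].
apply: (string3_zy (r := r) (s := s)) => //.
- by rewrite -E_last -?Ecal'_n; [apply: E'_e_last|]; idx.
- by rewrite -E_last -?Ecal'_n; [apply: E'_e_last|]; idx.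
- by apply: EE_row; idx.
- by rewrite -E_last; [apply: EE_inner|]; idx.
Qed.

Lemma E'E'_last k i : (1 <= k < i)%N -> (i < n)%N -> qc (s ^+ 2) (E' k n) (E' i n).
Proof.
move=> Hk Hi; rewrite !Ecal'_n !E_last; [|idx..].
apply: (string3_zz (r := r) (s := s)) => //.
- by rewrite -E_last -?Ecal'_n; [apply: E'_e_last|]; idx.
- by rewrite -E_last -?Ecal'_n; [apply: E'_e_last|]; idx.
- by apply: EE_row; idx.
- by rewrite -E_last; [apply: EE_inner|]; idx.
Qed.

(** The base case [E' k n.-1] is [string3_tail], whose second string starts at [e n.-1]; the
    generators below [n.-1] adjoined later commute with [e n]. *)
Lemma E'_e_n k j : (1 <= k < j)%N -> (j < n)%N ->
  qc (r ^+ 2 * s ^+ 2) (E' k j) (e n).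
Proof.
move=> Hk Hj; apply: (@Ecal'_from _ (qcl_br (z := e n)) _ _ n.-1); try idx.
  have En : n.-1.+1 = n by idx.
  rewrite /qcl Ecal'_S ?En; last idx.
  rewrite Ecal'_n E_last; last idx.
  apply: (string3_tail (r := r) (s := s)) => //.
  - by rewrite -E_last -?Ecal'_n; [apply: E'_e_last|]; idx.
  - rewrite -[e n.-1]Ecal_id -E_last -?Ecal'_n; [apply: E'_e_last|]; idx.
  - by rewrite -[e n.-1]Ecal_id; apply: EE_row; idx.
  - by rewrite -[e n.-1]Ecal_id -E_last; [apply: EE_inner|]; idx.
by move=> i Hi; apply: serre1; idx.
Qed.

Lemma E'_e_bot k j : (1 <= k)%N -> (k.+1 < j <= n)%N -> qc (s ^+ 2)^-1 (E' k j) (e k).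
Proof.
move=> Hk Hj.
apply: (@Ecal'_fromE _ (qcl_br (z := e k)) (s ^+ 2)^-1 1); rewrite ?mulr1 //; try idx.
- by apply: E_e_bot; idx.
- by apply: serre1; idx.
- by move=> i Hi; apply: serre1; idx.
Qed.

Lemma EE'_last k : (1 <= k < n)%N -> qc (s ^+ 2) (E k n) (E' k n).
Proof.
move=> Hk; rewrite Ecal'_n !E_last //.
apply: (string3_self r0 s0); rewrite -E_last // -?Ecal'_n; first exact: E'_e_last.
by have := @EE_column k n.-1; rewrite prednK; [apply|]; idx.
Qed.

Lemma EE'_gap k i : (1 <= k < i)%N -> (i < n)%N -> qc (s ^+ 2) (E k i.-1) (E' k i.+1).
Proof.
move=> Hk Hi; apply: (Ecal_first (qcl_br (z := E' k i.+1))); try idx.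
- by apply: qc_sym => //; apply: E'_e_bot; idx.
- by move=> m Hm; apply: qc1_sym; apply: E'_e_low; idx.
Qed.

(** The same generator [e i] moves [E k i.-1] and [E' k i.+1] to the two vectors here, so [string2]
    applies to [EE'_gap]. Its equation [k (s^-2 + r^-2) = s^2 (r^2 + s^2)] yields the scalar
    [r^2 s^4]. *)
Lemma EE'_same k i : (1 <= k < i)%N -> (i < n)%N ->
  qc (r ^+ 2 * s ^+ 4) (E k i) (E' k i).
Proof.
move=> Hk Hi.
have Ei : E k i = br (r ^+ 2) (E k i.-1) (e i).
  by have := @Ecal_r k i.-1; rewrite prednK; [apply|]; idx.
rewrite Ei Ecal'_S //.
apply: (string2 (b := s ^+ 2) (b2 := (r ^+ 2)^-1) _ _ (c := s ^+ 2)); rewrite -?Ecal'_S -?Ei //.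
- by field; rewrite r0 s0.
- by field; rewrite r0 s0.
- exact: E_e_top.
- exact: E'_e_top.
- exact: EE'_gap.
Qed.

Lemma E'E_n k i : (1 <= k < i)%N -> (i < n)%N -> qc (s ^+ 2)^-1 (E' k i) (E k n).
Proof.
move=> Hk Hi; rewrite E_last; last idx.
apply: (qc_brr _ (c := (r ^+ 2 * s ^+ 4)^-1) (d := r ^+ 2 * s ^+ 2)).
- by field; rewrite r0 s0.
- apply: (@Ecal_from _ (qcr_br (z := E' k i)) _ _ i); try idx.
    apply: qc_sym; first by rewrite invr_eq0 mulf_neq0 ?expf_neq0.
    by rewrite invrK; apply: EE'_same.
  by move=> m Hm; apply: E'_e_above; idx.
- exact: E'_e_n.
Qed.

Lemma E'E'_column k i : (1 <= k < i)%N -> (i < n)%N ->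
  qc (r ^+ 2)^-1 (E' k i.+1) (E' k i).
Proof.
move=> Hk Hi; apply: qc_sym; first by rewrite invr_eq0.
rewrite invrK.
apply: (@Ecal'_fromE _ (qcr_br (z := E' k i)) (s ^+ 2)^-1 (r ^+ 2 * s ^+ 2)); try idx.
- by field; rewrite s0.
- exact: E'E_n.
- exact: E'_e_n.
- by move=> m Hm; apply: E'_e_above; idx.
Qed.

(** Downward from [j = n]: both strings have equal weights, so [string2] keeps the scalar. *)
Lemma E'E'_row k i j : (1 <= k < i)%N -> (i < j <= n)%N ->
  qc (s ^+ 2) (E' k j) (E' i j).
Proof.
move=> Hk; move Dm: (n - j)%N => m; elim: m j Dm => [|m IH] j Dm Hj.
  have -> : j = n by idx.
  by apply: E'E'_last; idx.
rewrite (@Ecal'_S k j) ?(@Ecal'_S i j); [|idx..].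
apply: (string2 (b := (r ^+ 2)^-1) (b2 := (r ^+ 2)^-1) _ _ (c := s ^+ 2)); rewrite -?Ecal'_S //; try idx.
- by rewrite mulrC.
- by apply: E'_e_top; idx.
- by apply: E'_e_top; idx.
- by apply: IH; idx.
Qed.

Implicit Types (a b c d t : F) (x y z : A).

Section TwoEnds.
Variable Q : F -> A -> Prop.
Hypothesis Qbr : forall k c d t x y, k = c * d -> Q c x -> Q d y -> Q k (br t x y).

Lemma Ecal_first2 a b c k j : (1 <= k < j)%N -> (j <= n)%N -> c = a * b ->
  Q a (e k) -> Q b (e k.+1) -> (forall i, (k.+1 < i <= j)%N -> Q 1 (e i)) ->
  Q c (E k j).
Proof.
move=> Hk Hj cE Ha Hb He; rewrite Ecal_l; last idx.
by apply: (Qbr _ cE Ha); apply: Ecal_first => //; idx.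
Qed.

Lemma Ecal_last2 a b c k j : (1 <= k < j)%N -> (j <= n)%N -> c = a * b ->
  Q a (e j.-1) -> Q b (e j) -> (forall i, (k <= i < j.-1)%N -> Q 1 (e i)) ->
  Q c (E k j).
Proof.
case: j => [|j] Hk Hj cE Ha Hb He; first idx.
rewrite Ecal_r; [|idx..].
by apply: (Qbr _ cE _ Hb); apply: Ecal_last => //; idx.
Qed.

Lemma Ecal_mid3 a b c d k m j : (1 <= k < m)%N -> (m < j <= n)%N -> d = a * b * c ->
  Q a (e m.-1) -> Q b (e m) -> Q c (e m.+1) ->
  (forall i, (k <= i <= j)%N -> (i.+1 < m)%N || (m.+1 < i)%N -> Q 1 (e i)) ->
  Q d (E k j).
Proof.
move=> Hk Hj dE Ha Hb Hc He.
apply: (@Ecal_from _ Qbr _ _ m.+1); try idx; last by move=> i Hi; apply: He; idx.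
rewrite Ecal_r; [|idx..]; apply: (Qbr _ dE _ Hc).
by apply: (@Ecal_last2 a b) => //; try idx; move=> i Hi; apply: He; idx.
Qed.

Lemma Ecal'_to c d b k m : (m <= n)%N -> b = c * d ->
  Q c (E k n) -> Q d (e m) -> (forall i, (m < i <= n)%N -> Q 1 (e i)) ->
  Q b (E' k m).
Proof.
move=> Hm bE Hc Hd He; have [En | ne] := eqVneq m n.
  by rewrite En in Hd *; rewrite Ecal'_n; apply: (Qbr _ bE Hc).
rewrite Ecal'_S; last idx.
apply: (Qbr _ bE _ Hd); apply: (@Ecal'_fromE _ Qbr c 1); rewrite ?mulr1 //; try idx.
- by apply: He; idx.
- by move=> i Hi; apply: He; idx.
Qed.
End TwoEnds.

(** * Commutators of the root vectors with the [f m] *)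

Lemma br_qcl t b x y : b != 0 -> qc b x y -> br t x y = (1 - t / b) *: (x * y).
Proof.
by move=> b0; rewrite /br /qc => ->; rewrite -scalerBl scalerA; congr (_ *: _); field.
Qed.

Lemma br_qcr t b x y : qc b y x -> br t x y = (1 - t * b) *: (x * y).
Proof. by rewrite /br /qc => ->; rewrite scalerBl scale1r scalerA. Qed.

Lemma br_mulw t b x y z : b != 0 -> qc b y z ->
  br t (x * z) y = b^-1 *: (br (t * b) x y * z).
Proof.
move=> b0 /qc_br0 H.
apply: (eq_of_sub (t := - b^-1 *: (x * br b y z))).
  by rewrite /br; ncring F A; field.
by rewrite H mulr0 scaler0.
Qed.

Lemma e_f_ne i m : (1 <= i <= n)%N -> (1 <= m <= n)%N -> i != m -> qc 1 (e i) (f m).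
Proof.
move=> Hi Hm nim; apply/qc_br0; rewrite /br scale1r e_f //.
by rewrite (negPf nim).
Qed.

Lemma e_f_eq m : (1 <= m <= n)%N ->
  br 1 (e m) (f m) = (ri r n m - si s n m)^-1 *: (w m - w' m).
Proof. by move=> Hm; rewrite /br scale1r e_f // eqxx. Qed.

(** Commuting with [f m] replaces [e m] by a multiple of [w m - w' m]. The bracket scalar [t] is
    exactly the weight of [x] against [w m], so only the [w' m] term survives. In [lower_left] it is
    the [w' m] term that cancels. *)
Lemma lower_right t b x m : (1 <= m <= n)%N -> b != 0 ->
  qc 1 x (f m) -> qc t x (w m) -> qc b x (w' m) ->
  exists c, br 1 (br t x (e m)) (f m) = c *: (x * w' m).
Proof.
move=> Hm b0 /qc_br0 Hx /qc_br0 Hw Hw'.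
rewrite br1_br Hx br0l add0r e_f_eq // brZr brBr Hw sub0r (br_qcl t b0 Hw').
by rewrite -scaleNr scalerA; eexists.
Qed.

Lemma lower_left t b y m : (1 <= m <= n)%N -> t != 0 ->
  qc 1 y (f m) -> qc b y (w m) -> qc t^-1 y (w' m) ->
  exists c, br 1 (br t (e m) y) (f m) = c *: (w m * y).
Proof.
move=> Hm t0 /qc_br0 Hy Hw Hw'.
rewrite br1_br Hy br0r addr0 e_f_eq // brZl brBl (br_qcr t Hw) (br_qcr t Hw').
by rewrite divff // subrr scale0r subr0 scalerA; eexists.
Qed.

Lemma ew_diag m : (1 <= m < n)%N -> qc (s ^+ 2 / r ^+ 2) (e m) (w m).
Proof.
move=> Hm; have := @e_w m m; rewrite pairing_diag ?invf_div; last idx.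
by apply; idx.
Qed.

Lemma ew_up m : (1 <= m < n)%N -> qc (s ^+ 2)^-1 (e m.+1) (w m).
Proof.
by move=> Hm; have := @e_w m.+1 m; rewrite pairing_down; [apply|]; idx.
Qed.

Lemma ew_down m : (1 < m <= n)%N -> qc (r ^+ 2) (e m.-1) (w m).
Proof.
case: m => [|m] Hm; first idx.
by have := @e_w m m.+1; rewrite pairing_up ?invrK; [apply|]; idx.
Qed.

Lemma ew_far i m : (1 <= m <= n)%N -> (1 <= i <= n)%N ->
  (i.+1 < m)%N || (m.+1 < i)%N -> qc 1 (e i) (w m).
Proof.
by move=> Hm Hi Him; have := @e_w i m; rewrite pairing_far ?invr1; [apply|]; idx.
Qed.

Lemma ew_last : (0 < n)%N -> qc (s / r) (e n) (w n).
Proof.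
by move=> Hn; have := @e_w n n; rewrite pairing_last invf_div; apply; idx.
Qed.

Lemma ew'_diag m : (1 <= m < n)%N -> qc (r ^+ 2 / s ^+ 2) (e m) (w' m).
Proof.
by move=> Hm; have := @e_w' m m; rewrite pairing_diag; [apply|]; idx.
Qed.

Lemma ew'_up m : (1 <= m < n)%N -> qc (r ^+ 2)^-1 (e m.+1) (w' m).
Proof.
by move=> Hm; have := @e_w' m.+1 m; rewrite pairing_up; [apply|]; idx.
Qed.

Lemma ew'_down m : (1 < m <= n)%N -> qc (s ^+ 2) (e m.-1) (w' m).
Proof.
case: m => [|m] Hm; first idx.
by have := @e_w' m m.+1; rewrite pairing_down; [apply|]; idx.
Qed.

Lemma ew'_far i m : (1 <= m <= n)%N -> (1 <= i <= n)%N ->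
  (i.+1 < m)%N || (m.+1 < i)%N -> qc 1 (e i) (w' m).
Proof.
move=> Hm Hi Him; have := @e_w' i m; rewrite pairing_far; first by apply; idx.
by rewrite orbC.
Qed.

Lemma ew'_last : (0 < n)%N -> qc (r / s) (e n) (w' n).
Proof.
by move=> Hn; have := @e_w' n n; rewrite pairing_last; apply; idx.
Qed.

Lemma E_f_far k j m : (1 <= k <= j)%N -> (j <= n)%N -> (1 <= m <= n)%N ->
  (m < k)%N || (j < m)%N -> qc 1 (E k j) (f m).
Proof.
move=> Hk Hj Hm Hkm; apply: (Ecal_all (qcl_br (z := f m))) => // i Hi.
by apply: e_f_ne; idx.
Qed.

Lemma E_f_last k j : (1 <= k < j)%N -> (j <= n)%N ->
  exists c, br 1 (E k j) (f j) = c *: (E k j.-1 * w' j).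
Proof.
case: j => [|j] Hk Hj; first idx.
rewrite Ecal_r; [|idx..].
apply: (lower_right (b := s ^+ 2)) => //; try idx.
- by apply: E_f_far; idx.
- apply: (Ecal_last (qcl_br (z := w j.+1))); try idx.
    by apply: (@ew_down j.+1); idx.
  by move=> i Hi; apply: ew_far; idx.
- apply: (Ecal_last (qcl_br (z := w' j.+1))); try idx.
    by apply: (@ew'_down j.+1); idx.
  by move=> i Hi; apply: ew'_far; idx.
Qed.

(** [f m] lowers [E k m] to a multiple of [E k m.-1 * w' m]. The twist by [w' m] turns the bracket
    with [e m.+1] into a plain commutator, and [E k m.-1] commutes with [e m.+1]. *)
Lemma E_f_mid k m j : (1 <= k < m)%N -> (m < j <= n)%N -> qc 1 (E k j) (f m).
Proof.
move=> Hk Hj; apply: (@Ecal_from _ (qcl_br (z := f m)) _ _ m.+1); try idx.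
  have [||c Hc] := @E_f_last k m; try idx.
  apply/qc_br0; rewrite Ecal_r; [|idx..].
  have /qc_br0 He : qc 1 (e m.+1) (f m) by apply: e_f_ne; idx.
  have Hw : qc (r ^+ 2)^-1 (e m.+1) (w' m) by apply: ew'_up; idx.
  rewrite br1_br He br0r addr0 Hc brZl (br_mulw _ _ _ Hw) ?invr_eq0 // divff //.
  have /qc_br0 -> : qc 1 (E k m.-1) (e m.+1) by apply: E_e_far; idx.
  by rewrite mul0r !scaler0.
by move=> i Hi; apply: e_f_ne; idx.
Qed.

Lemma E_w_first k j : (1 <= k <= j)%N -> (1 < k)%N -> (j <= n)%N ->
  qc (s ^+ 2)^-1 (E k j) (w k.-1) /\ qc (r ^+ 2)^-1 (E k j) (w' k.-1).
Proof.
case: k => [|k] Hk k1 Hj; first idx.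
split; [apply: (Ecal_first (qcl_br (z := w k))) | apply: (Ecal_first (qcl_br (z := w' k)))];
  try idx.
- by apply: ew_up; idx.
- by move=> i Hi; apply: ew_far; idx.
- by apply: ew'_up; idx.
- by move=> i Hi; apply: ew'_far; idx.
Qed.

Lemma E_f_first k j : (1 <= k < j)%N -> (j <= n)%N ->
  exists c, br 1 (E k j) (f k) = c *: (w k * E k.+1 j).
Proof.
move=> Hk Hj; rewrite Ecal_l; last idx.
have [||| /= Hw Hw'] := @E_w_first k.+1 j; try idx.
by apply: (lower_left _ _ _ Hw) => //; [|apply: E_f_far]; idx.
Qed.

Lemma E'_f_first k j : (1 <= k)%N -> (k.+1 < j <= n)%N ->
  exists c, br 1 (E' k j) (f k) = c *: (w k * E' k.+1 j).
Proof.
move=> Hk Hj; rewrite Ecal'_l //.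
have [||| /= Hw Hw'] := @E_w_first k.+1 n; try idx.
apply: (@lower_left _ (s ^+ 2)^-1) => //; try idx.
- apply: (@Ecal'_fromE _ (qcl_br (z := f k)) 1 1); rewrite ?mulr1 //; try idx.
  + by apply: E_f_far; idx.
  + by apply: e_f_ne; idx.
  + by move=> i Hi; apply: e_f_ne; idx.
- apply: (@Ecal'_fromE _ (qcl_br (z := w k)) (s ^+ 2)^-1 1); rewrite ?mulr1 //; try idx.
  + by apply: ew_far; idx.
  + by move=> i Hi; apply: ew_far; idx.
- apply: (@Ecal'_fromE _ (qcl_br (z := w' k)) (r ^+ 2)^-1 1); rewrite ?mulr1 //; try idx.
  + by apply: ew'_far; idx.
  + by move=> i Hi; apply: ew'_far; idx.
Qed.

Lemma E_w_last k : (1 <= k < n)%N ->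
  qc (r * s) (E k n) (w n) /\ qc (r * s) (E k n) (w' n).
Proof.
move=> Hk; split.
- apply: (Ecal_last2 (qcl_br (z := w n)) (a := r ^+ 2) (b := s / r)); try idx.
  + by field.
  + by apply: ew_down; idx.
  + by apply: ew_last; idx.
  + by move=> i Hi; apply: ew_far; idx.
- apply: (Ecal_last2 (qcl_br (z := w' n)) (a := s ^+ 2) (b := r / s)); try idx.
  + by field.
  + by apply: ew'_down; idx.
  + by apply: ew'_last; idx.
  + by move=> i Hi; apply: ew'_far; idx.
Qed.

Lemma E'_f_n k : (1 <= k < n)%N ->
  exists c, br 1 (E' k n) (f n) = c *: (E k n * w' n).
Proof.
move=> Hk; have [||c Hc] := @E_f_last k n; try idx.
have [/qc_br0 Hw Hw'] := E_w_last Hk.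
have He : qc (r / s) (e n) (w' n) by apply: ew'_last; idx.
(* [f n] meets [e n] both inside [E k n] and in the outer bracket. The twist by [w' n] changes the
   outer scalar [rs] of the first contribution to [r^2], which rebuilds [E k n]. *)
rewrite Ecal'_n br1_br Hc brZl (br_mulw _ _ _ He); last by rewrite mulf_neq0 ?invr_neq0.
have -> : r * s * (r / s) = r ^+ 2 by field.
rewrite -E_last // e_f_eq; last idx.
rewrite brZr brBr Hw sub0r (br_qcl _ rs0 Hw') -scaleNr !scalerA -scalerDl.
by eexists.
Qed.

Lemma E'_w_above k j : (1 <= k < j)%N -> (j < n)%N ->
  qc (s ^+ 2)^-1 (E' k j.+1) (w j) /\ qc (r ^+ 2)^-1 (E' k j.+1) (w' j).
Proof.
move=> Hk Hj; split.
- apply: (@Ecal'_to _ (qcl_br (z := w j)) 1 (s ^+ 2)^-1); rewrite ?mul1r //; try idx.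
  + apply: (Ecal_mid3 (qcl_br (z := w j)) (a := r ^+ 2) (b := s ^+ 2 / r ^+ 2)
      (c := (s ^+ 2)^-1) (m := j)) => //; try idx.
    * by field; rewrite r0 s0.
    * by apply: ew_down; idx.
    * by apply: ew_diag; idx.
    * by apply: ew_up; idx.
    * by move=> i Hi Hij; apply: ew_far; idx.
  + by apply: ew_up; idx.
  + by move=> i Hi; apply: ew_far; idx.
- apply: (@Ecal'_to _ (qcl_br (z := w' j)) 1 (r ^+ 2)^-1); rewrite ?mul1r //; try idx.
  + apply: (Ecal_mid3 (qcl_br (z := w' j)) (a := s ^+ 2) (b := r ^+ 2 / s ^+ 2)
      (c := (r ^+ 2)^-1) (m := j)) => //; try idx.
    * by field; rewrite r0 s0.
    * by apply: ew'_down; idx.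
    * by apply: ew'_diag; idx.
    * by apply: ew'_up; idx.
    * by move=> i Hi Hij; apply: ew'_far; idx.
  + by apply: ew'_up; idx.
  + by move=> i Hi; apply: ew'_far; idx.
Qed.

Lemma E'_f_low k j m : (1 <= k)%N -> (k < m < j)%N || (m < k)%N ->
  (1 <= m)%N -> (j <= n)%N -> (k < n)%N -> (k < j)%N -> qc 1 (E' k j) (f m).
Proof.
move=> Hk Hkm Hm Hj Hkn Hkj.
apply: (@Ecal'_fromE _ (qcl_br (z := f m)) 1 1); rewrite ?mulr1 //; try idx.
- have [lt_mk | le_km] := ltnP m k; first by apply: E_f_far; idx.
  by apply: E_f_mid; idx.
- by apply: e_f_ne; idx.
- by move=> i Hi; apply: e_f_ne; idx.
Qed.

Lemma E'_f_top k j : (1 <= k < j)%N -> (j < n)%N ->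
  exists c, br 1 (E' k j) (f j) = c *: (E' k j.+1 * w' j).
Proof.
move=> Hk Hj; rewrite Ecal'_S //.
have [Hw Hw'] := E'_w_above Hk Hj.
apply: (lower_right _ _ _ Hw Hw'); rewrite ?invr_eq0 //; try idx.
by apply: E'_f_low; idx.
Qed.

Lemma E'_f_above k j m : (1 <= k < j)%N -> (j < m <= n)%N -> qc 1 (E' k j) (f m).
Proof.
move=> Hk Hj.
apply: (@Ecal'_from _ (qcl_br (z := f m)) _ _ m.-1); try idx.
  case: m Hj => [|m] Hj; first idx.
  apply/qc_br0; rewrite Ecal'_S; last idx.
  have /qc_br0 He : qc 1 (e m) (f m.+1) by apply: e_f_ne; idx.
  have Hw : qc (s ^+ 2) (e m) (w' m.+1) by apply: (@ew'_down m.+1); idx.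
  rewrite br1_br He br0r addr0.
  (* Lowering yields [E k n] at the last node and a vector [E'] otherwise; either one commutes with
     [e m]. *)
  have [c [y [-> /qc_br0 Hy]]] : exists c y,
      br 1 (E' k m.+1) (f m.+1) = c *: (y * w' m.+1) /\ qc 1 y (e m).
    have [En | ne] := eqVneq m.+1 n.
      have [|c Hc] := @E'_f_n k; first idx.
      exists c, (E k n); rewrite En; split=> //; apply: E_e_mid; idx.
    have [||c Hc] := @E'_f_top k m.+1; try idx.
    by exists c, (E' k m.+2); split=> //; apply: E'_e_low; idx.
  by rewrite brZl (br_mulw _ _ _ Hw) // mulVf // Hy mul0r !scaler0.
by move=> i Hi; apply: e_f_ne; idx.
Qed.

Lemma br_exch a b x y z : qc 1 x y -> br a x (br b y z) = br b y (br a x z).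
Proof.
move=> /qc_br0 H.
apply: (eq_of_sub (t := br 1 x y * z - (a * b) *: (z * br 1 x y))).
  by rewrite /br; ncring F A; ring.
by rewrite H mulr0 mul0r scaler0 subrr.
Qed.

(** A single use of the Leibniz rule on [x y = c y x]. *)
Lemma string2_once a a2 c x y z : qc c x y ->
  x * br a2 y z - (c * a) *: (br a2 y z * x)
  = c *: (y * br a x z) - a2 *: (br a x z * y).
Proof.
move=> /qc_br0 H; apply: (eq_of_sub (t := br (a * a2) (br c x y) z)).
  by rewrite /br; ncring F A; ring.
by rewrite H br0l.
Qed.

Hypothesis h2m : r ^+ 2 != s ^+ 2.
Variable l : nat.
Hypotheses (l0 : (0 < l)%N) (rl : r ^+ l = 1) (sl : s ^+ l = 1).

(** * Sets of distinct [l]-th roots of unity *)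

Definition good S := uniq S && all (fun a => a ^+ l == 1) S.

Lemma good_comm S x y : good S -> ann S x y -> GRing.comm (x ^+ l) y.
Proof. by case/andP => uS rS; apply: ann_expr_comm. Qed.

Let pow_unity i : (r ^+ i) ^+ l = 1 /\ (s ^+ i) ^+ l = 1.
Proof. by rewrite !(exprAC _ i) rl sl !expr1n. Qed.

(** The factor [k] clears denominators, turning [a - b] into [r - s], [r^2 - s^2] or [r^4 - s^4]. *)
Lemma neq_scale k d a b : d != 0 -> d = k * (a - b) -> a != b.
Proof. by move=> d0 dE; apply: contraNneq d0 => ab; rewrite dE ab subrr mulr0. Qed.

Let d2 : r ^+ 2 - s ^+ 2 != 0. Proof. by rewrite subr_eq0. Qed.
Let d1 : r - s != 0.
Proof. by apply: contraNneq h2m => /subr0_eq ->. Qed.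

Let r2l := (pow_unity 2).1.
Let s2l := (pow_unity 2).2.
Let s4l := (pow_unity 4).2.
Let unityE := (exprMn, exprVn, r2l, s2l, s4l, rl, sl, expr1n, invr1, mulr1).

Lemma good1 a : a ^+ l = 1 -> good [:: a].
Proof. by rewrite /good /= => ->; rewrite eqxx. Qed.

Lemma good2 a b : a ^+ l = 1 -> b ^+ l = 1 -> a != b -> good [:: a; b].
Proof. by rewrite /good /= inE => -> -> ->; rewrite eqxx. Qed.

Lemma good3 a b c : a ^+ l = 1 -> b ^+ l = 1 -> c ^+ l = 1 ->
  a != b -> a != c -> b != c -> good [:: a; b; c].
Proof.
by rewrite /good /= !inE => -> -> -> /negPf-> /negPf-> /negPf->; rewrite eqxx.
Qed.

Lemma good_r2_s2 : good [:: r ^+ 2; s ^+ 2].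
Proof. by apply: good2. Qed.

Lemma good_r2V_s2V : good [:: (r ^+ 2)^-1; (s ^+ 2)^-1].
Proof.
apply: good2; rewrite ?unityE //.
by apply: (neq_scale (k := - (r ^+ 2 * s ^+ 2)) d2); field; rewrite r0 s0.
Qed.

Lemma good_s2V_r2V : good [:: (s ^+ 2)^-1; (r ^+ 2)^-1].
Proof.
apply: good2; rewrite ?unityE //.
by apply: (neq_scale (k := r ^+ 2 * s ^+ 2) d2); field; rewrite r0 s0.
Qed.

Lemma good_rs_s2 : good [:: r * s; s ^+ 2].
Proof.
apply: good2; rewrite ?unityE //.
by apply: (neq_scale (k := s^-1) d1); field.
Qed.

Lemma good_serre3 : good [:: (r ^+ 2)^-1; (r * s)^-1; (s ^+ 2)^-1].
Proof.
apply: good3; rewrite ?unityE //.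
- by apply: (neq_scale (k := - (r ^+ 2 * s)) d1); field; rewrite r0 s0.
- by apply: (neq_scale (k := - (r ^+ 2 * s ^+ 2)) d2); field; rewrite r0 s0.
- by apply: (neq_scale (k := - (r * s ^+ 2)) d1); field; rewrite r0 s0.
Qed.

Lemma good_1_s2r2 : good [:: 1; s ^+ 2 / r ^+ 2].
Proof.
by apply: good2; rewrite ?unityE //; apply: (neq_scale (k := r ^+ 2) d2); field.
Qed.

Lemma good_1_r2s2 : good [:: 1; r ^+ 2 / s ^+ 2].
Proof.
by apply: good2; rewrite ?unityE //; apply: (neq_scale (k := - s ^+ 2) d2); field.
Qed.

Lemma good_1_rs : good [:: 1; r / s].
Proof.
by apply: good2; rewrite ?unityE //; apply: (neq_scale (k := - s) d1); field.
Qed.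

Lemma good_1_sr_s2r2 : good [:: 1; s / r; s ^+ 2 / r ^+ 2].
Proof.
apply: good3; rewrite ?unityE //.
- by apply: (neq_scale (k := r) d1); field.
- by apply: (neq_scale (k := r ^+ 2) d2); field.
- by apply: (neq_scale (k := r ^+ 2 / s) d1); field; rewrite r0 s0.
Qed.

Lemma good_r2s2V_s4V : good [:: (r ^+ 2 * s ^+ 2)^-1; (s ^+ 4)^-1].
Proof.
apply: good2; rewrite ?unityE //.
by apply: (neq_scale (k := - (r ^+ 2 * s ^+ 4)) d2); field; rewrite r0 s0.
Qed.

Lemma good_pairing m : (1 <= m <= n)%N -> good [:: 1; p m m; (p m m)^-1].
Proof.
move=> Hm; have [lt_mn | le_nm] := ltnP m n.
  rewrite pairing_diag //; apply: good3; rewrite ?unityE //.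
  - by apply: (neq_scale (k := - s ^+ 2) d2); field.
  - by apply: (neq_scale (k := r ^+ 2) d2); field; rewrite r0 s0.
  (* [r^2 / s^2] differs from its inverse exactly when [r^4 != s^4]. *)
  - have d4 : (r ^+ 2 - s ^+ 2) * (r ^+ 2 + s ^+ 2) != 0 by rewrite mulf_neq0.
    by apply: (neq_scale (k := r ^+ 2 * s ^+ 2) d4); field; rewrite r0 s0.
have -> : m = n by idx.
rewrite pairing_last; apply: good3; rewrite ?unityE //.
- by apply: (neq_scale (k := - s) d1); field.
- by apply: (neq_scale (k := r) d1); field; rewrite r0 s0.
- by apply: (neq_scale (k := r * s) d2); field; rewrite r0 s0.
Qed.

Lemma qc_pow c x y : c ^+ l = 1 -> qc c x y -> GRing.comm (x ^+ l) y.
Proof. by move=> cl /ann_qc; apply: good_comm; apply: good1. Qed.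

Lemma qc1_pow x y : qc 1 x y -> GRing.comm (x ^+ l) y.
Proof. by apply: qc_pow; rewrite expr1n. Qed.

(** * Powers of root vectors against the generators [e m] and [f m] *)

Lemma br_EV_e m j : (m.+1 <= j)%N ->
  br (r ^+ 2)^-1 (E m.+1 j) (e m) = - (r ^+ 2)^-1 *: E m j.
Proof. by move=> Hm; rewrite br_swap // -Ecal_l. Qed.

(** For [j = n] and [m.+1 < n], the second bracket, of the short root vectors [E m.+1 n] and
    [E m n], becomes by [br_exch] one of [E m.+1 n.-1] with [E' m n]. Both of these [q]-commute with
    [E m.+1 n], so the three scalars of [serre_last] suffice. *)
Lemma E_pow_pred m j : (1 <= m < j)%N -> (j <= n)%N ->
  GRing.comm (E m.+1 j ^+ l) (e m).
Proof.
move=> Hm Hj; have [lt_jn | le_nj] := ltnP j n.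
  apply: (good_comm good_r2V_s2V); apply: (ann_cons (br_EV_e _)); first idx.
  apply: ann_qc; apply: qc_sym; first by rewrite invr_eq0.
  by rewrite invrK; apply: EE_row; idx.
have Ejn : j = n by idx.
rewrite {}Ejn in Hm *; apply: (good_comm good_serre3).
have [Emn | ne] := eqVneq m.+1 n.
  by rewrite Emn Ecal_id; apply: serre_last; idx.
apply: (ann_cons (br_EV_e _)); first idx.
apply: (ann_cons (br_swap _ _ rs0)); apply: ann_qc.
rewrite (@E_last m.+1); last idx.
rewrite br_exch; last by apply: EE_inner; idx.
rewrite -Ecal'_n -E_last; last idx.
apply: (qc_brr _ (c := (s ^+ 2)^-1) (d := 1)); first by rewrite mulr1.
- apply: qc_sym; first by rewrite invr_eq0.
  by rewrite invrK; have := @EE_column m.+1 n.-1; rewrite prednK; [apply|]; idx.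
- by apply: qc1_sym; apply: E'E_last; idx.
Qed.

Lemma E_pow_e k j m : (1 <= k <= j)%N -> (j <= n)%N -> (1 <= m <= n)%N ->
  GRing.comm (E k j ^+ l) (e m).
Proof.
move=> Hk Hj Hm.
have [far | near] := boolP ((j.+1 < m) || (m.+1 < k))%N.
  by apply: qc1_pow; apply: E_e_far.
have [Em | nm1] := eqVneq m j.+1.
  rewrite {}Em in Hm near *; apply: (good_comm good_r2_s2).
  apply: (ann_cons (t := 1) (z := E k j.+1)); first by rewrite scale1r Ecal_r //; idx.
  by apply: ann_qc; apply: EE_column; idx.
have [Em | nm2] := eqVneq m.+1 k.
  by rewrite -{}Em in Hk near *; apply: E_pow_pred; idx.
have [Em | nm3] := eqVneq m k.
  rewrite {}Em; have [Ek | nk] := eqVneq k j.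
    rewrite -Ek Ecal_id; apply: qc1_pow; exact/qc1P.
  by apply: (qc_pow _ (E_e_bot _ _)); rewrite ?unityE //; idx.
have [Em | nm4] := eqVneq m j; last by apply: qc1_pow; apply: E_e_mid; idx.
rewrite {}Em; have [lt_jn | le_nj] := ltnP j n.
  by apply: (qc_pow _ (E_e_top _ _)); rewrite ?unityE //; idx.
have -> : j = n by idx.
apply: (good_comm good_rs_s2).
apply: (ann_cons (t := 1) (z := E' k n)); first by rewrite scale1r Ecal'_n.
by apply: ann_qc; apply: EE'_last; idx.
Qed.

(** By [string2_once] the bracket with [e k] is a combination of products of two root vectors: the
    square of [E k n] if [k.+1 = n], otherwise [E' k k.+2] and [E k k.+1] in both orders. Each
    product [q]-commutes with scalar [s^-4], the second element of the set. *)
Lemma E'_pow_adjacent k : (1 <= k < n)%N -> GRing.comm (E' k k.+1 ^+ l) (e k).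
Proof.
move=> Hk; apply: (good_comm good_r2s2V_s4V).
have rs20 : r ^+ 2 * s ^+ 2 != 0 by rewrite mulf_neq0.
apply: (ann_cons (br_swap _ _ rs20)); apply: ann_qc.
have [Ek | nk] := eqVneq k.+1 n.
  have -> : br (r ^+ 2 * s ^+ 2) (e k) (E' k k.+1) = (s ^+ 2 - r * s) *: (E k n * E k n).
    have H : qc (s ^+ 2) (e k) (E k n).
      by apply: qc_sym => //; apply: E_e_bot; idx.
    have := string2_once (r ^+ 2) (r * s) (e n) H.
    rewrite Ek -Ecal'_n -{3 4}(Ecal_id k).
    have -> : br (r ^+ 2) (E k k) (e n) = E k n by have := @Ecal_r k k; rewrite Ek => -> //; idx.
    by rewrite scalerBl /br [s ^+ 2 * r ^+ 2]mulrC.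
  rewrite Ek; apply: qcZr.
  have H : qc (s ^+ 2)^-1 (E' k n) (E k n).
    apply: qc_sym; first by rewrite invr_eq0.
    by rewrite invrK; apply: EE'_last; idx.
  have -> : (s ^+ 4)^-1 = (s ^+ 2)^-1 * (s ^+ 2)^-1 by field.
  exact: qcMr.
have H : qc (s ^+ 2) (e k) (E' k k.+2).
  by apply: qc_sym => //; apply: E'_e_bot; idx.
have := string2_once (r ^+ 2) (s ^+ 2)^-1 (e k.+1) H.
rewrite -Ecal'_S -?(Ecal_id k); last idx.
rewrite -Ecal_r; [|idx..].
rewrite [s ^+ 2 * r ^+ 2]mulrC -/(br _ _ _) => ->.
have H1 : qc (r ^+ 2) (E' k k.+1) (E' k k.+2).
  by apply: qc_sym => //; apply: E'E'_column; idx.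
have H2 : qc (r ^+ 2 * s ^+ 4)^-1 (E' k k.+1) (E k k.+1).
  apply: qc_sym; first by rewrite invr_eq0 mulf_neq0 ?expf_neq0.
  by rewrite invrK; apply: EE'_same; idx.
have -> : (s ^+ 4)^-1 = r ^+ 2 * (r ^+ 2 * s ^+ 4)^-1 by field; rewrite r0 s0.
apply: qcDr; first by apply: qcZr; apply: qcMr.
by apply: qcNr; apply: qcZr; rewrite mulrC; apply: qcMr.
Qed.

Lemma E'_pow_e k j m : (1 <= k < j)%N -> (j <= n)%N -> (1 <= m <= n)%N ->
  GRing.comm (E' k j ^+ l) (e m).
Proof.
move=> Hk Hj Hm.
have [far | near] := ltnP m.+1 k.
  apply: qc1_pow.
  apply: (@Ecal'_fromE _ (qcl_br (z := e m)) 1 1); rewrite ?mulr1 //; try idx.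
  - by apply: E_e_far; idx.
  - by apply: serre1; idx.
  - by move=> i Hi; apply: serre1; idx.
have [Em | nm1] := eqVneq m.+1 k.
  rewrite -{}Em in Hk near *; apply: (good_comm good_r2V_s2V).
  apply: (ann_cons (br_swap _ _ r20)); rewrite -Ecal'_l; [|idx..].
  apply: ann_qc; apply: qc_sym; first by rewrite invr_eq0.
  by rewrite invrK; apply: E'E'_row; idx.
have [Em | nm2] := eqVneq m k.
  rewrite {}Em; have [<- | nk] := eqVneq k.+1 j; first by apply: E'_pow_adjacent; idx.
  by apply: (qc_pow _ (E'_e_bot _ _)); rewrite ?unityE //; idx.
have [low | nlow] := ltnP m.+1 j; first by apply: qc1_pow; apply: E'_e_low; idx.
have [Em | nm3] := eqVneq m.+1 j.
  rewrite -{}Em in Hk Hj nlow *; apply: (good_comm good_s2V_r2V).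
  apply: (ann_cons (t := 1) (z := E' k m)); first by rewrite scale1r [RHS]Ecal'_S //; idx.
  by apply: ann_qc; apply: E'E'_column; idx.
have [Em | nm4] := eqVneq m j.
  rewrite {}Em; have [lt_jn | le_nj] := ltnP j n.
    by apply: (qc_pow _ (E'_e_top _ _)); rewrite ?unityE //; idx.
  have Ejn : j = n by idx.
  rewrite Ejn; apply: (qc_pow _ (E'_e_last _)); rewrite ?unityE //; idx.
have [lt_mn | le_nm] := ltnP m n; first by apply: qc1_pow; apply: E'_e_above; idx.
have -> : m = n by idx.
by apply: (qc_pow _ (E'_e_n _ _)); rewrite ?unityE //; idx.
Qed.

Lemma ann_lower a x y z c : br 1 x y = c *: z -> qc a x z -> ann [:: 1; a] x y.
Proof. by move=> H /ann_qc; apply: ann_cons H. Qed.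

(** The commutator is a multiple of [w m - w' m], whose two terms [q]-commute with [e m] with the
    inverse scalars [(p m m)^-1] and [p m m]. *)
Lemma e_pow_f m : (1 <= m <= n)%N -> GRing.comm (e m ^+ l) (f m).
Proof.
move=> Hm; apply: (good_comm (good_pairing Hm)).
apply: (ann_cons (e_f_eq Hm)); rewrite -scaleN1r; apply: annD.
- by apply: annC; apply: (ann_cons (t := 0) (z := 0)); rewrite /= ?br0r // scaler0; apply/qc_br0; apply: e_w.
- apply: annZ; apply: (ann_cons (t := 0) (z := 0)); rewrite /= ?br0r // scaler0.
  by apply/qc_br0; apply: e_w'.
Qed.

Lemma E_w_bot k j : (1 <= k < j)%N -> (j <= n)%N -> qc (r ^+ 2)^-1 (E k j) (w k).
Proof.
move=> Hk Hj.
apply: (Ecal_first2 (qcl_br (z := w k)) (a := s ^+ 2 / r ^+ 2) (b := (s ^+ 2)^-1)) => //.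
- by field; rewrite r0 s0.
- by apply: ew_diag; idx.
- by apply: ew_up; idx.
- by move=> i Hi; apply: ew_far; idx.
Qed.

Lemma E_w'_top k j : (1 <= k < j)%N -> (j < n)%N -> qc (r ^+ 2) (E k j) (w' j).
Proof.
move=> Hk Hj.
apply: (Ecal_last2 (qcl_br (z := w' j)) (a := s ^+ 2) (b := r ^+ 2 / s ^+ 2)); try idx.
- by field.
- by apply: ew'_down; idx.
- by apply: ew'_diag; idx.
- by move=> i Hi; apply: ew'_far; idx.
Qed.

Lemma E_pow_f k j m : (1 <= k <= j)%N -> (j <= n)%N -> (1 <= m <= n)%N ->
  GRing.comm (E k j ^+ l) (f m).
Proof.
move=> Hk Hj Hm.
have [far | near] := boolP ((j < m) || (m < k))%N.
  by apply: qc1_pow; apply: E_f_far; rewrite 1?orbC.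
have [Ekj | nkj] := eqVneq k j.
  have -> : m = k by idx.
  by rewrite -Ekj Ecal_id; apply: e_pow_f; idx.
have [Em | nm1] := eqVneq m k.
  rewrite {}Em; have [||c Hc] := @E_f_first k j; try idx.
  have Hw : qc (r ^+ 2)^-1 (E k j) (w k) by apply: E_w_bot; idx.
  have [lt_jn | le_nj] := ltnP j n.
    apply: (good_comm good_1_s2r2); apply: (ann_lower Hc).
    by rewrite mulrC; apply: qcMr => //; apply: EE_row; idx.
  have Ejn : j = n by idx.
  rewrite {}Ejn in Hk Hj nkj Hc Hw *; apply: (good_comm good_1_sr_s2r2).
  apply: (ann_cons Hc).
  (* [E k.+1 n] inherits the scalars [rs], [s^2] of [e n], because its other factor [E k.+1 n.-1],
     when present, commutes with [E k n]. The factor [w k] multiplies both by [r^-2]. *)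
  have -> : [:: s / r; s ^+ 2 / r ^+ 2] = [seq (r ^+ 2)^-1 * a | a <- [:: r * s; s ^+ 2]].
    by rewrite /=; congr [:: _; _]; field.
  apply: ann_mull Hw.
  have Hn : ann [:: r * s; s ^+ 2] (E k n) (e n).
    apply: (ann_cons (t := 1) (z := E' k n)); first by rewrite scale1r Ecal'_n.
    by apply: ann_qc; apply: EE'_last; idx.
  have [-> | ne] := eqVneq k.+1 n; first by rewrite Ecal_id.
  rewrite (@E_last k.+1); last idx.
  by apply: (ann_brr _ (map_mul1 _) Hn); apply: EE_inner; idx.
have [Em | nm2] := eqVneq m j; last by apply: qc1_pow; apply: E_f_mid; idx.
rewrite {}Em; have [||c Hc] := @E_f_last k j; try idx.
have HE : qc (s ^+ 2)^-1 (E k j) (E k j.-1).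
  apply: qc_sym; first by rewrite invr_eq0.
  by rewrite invrK; have := @EE_column k j.-1; rewrite prednK; [apply|]; idx.
have [lt_jn | le_nj] := ltnP j n.
  apply: (good_comm good_1_r2s2); apply: (ann_lower Hc).
  by rewrite mulrC; apply: qcMr => //; apply: E_w'_top; idx.
have Ejn : j = n by idx.
rewrite {}Ejn in Hk Hj nkj Hc HE *.
apply: (good_comm good_1_rs); apply: (ann_lower Hc).
have -> : r / s = (s ^+ 2)^-1 * (r * s) by field.
by have [|_ Hw] := @E_w_last k; [idx | apply: qcMr].
Qed.

Lemma E'_w'_top k j : (1 <= k < j)%N -> (j < n)%N -> qc (s ^+ 2)^-1 (E' k j) (w' j).
Proof.
move=> Hk Hj; rewrite Ecal'_S //; have [_ Hw] := E'_w_above Hk Hj.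
apply: (qc_brl _ _ Hw (ew'_diag _)); last idx.
by field; rewrite r0 s0.
Qed.

Lemma E'_w_bot k j : (1 <= k)%N -> (k.+1 < j <= n)%N -> qc (r ^+ 2)^-1 (E' k j) (w k).
Proof.
move=> Hk Hj.
apply: (@Ecal'_fromE _ (qcl_br (z := w k)) (r ^+ 2)^-1 1); rewrite ?mulr1 //; try idx.
- by apply: E_w_bot; idx.
- by apply: ew_far; idx.
- by move=> i Hi; apply: ew_far; idx.
Qed.

Lemma E'_w_adjacent k : (1 <= k < n)%N -> qc (r ^+ 2 * s ^+ 2)^-1 (E' k k.+1) (w k).
Proof.
move=> Hk.
apply: (@Ecal'_to _ (qcl_br (z := w k)) (r ^+ 2)^-1 (s ^+ 2)^-1); try idx.
- by field; rewrite r0 s0.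
- by apply: E_w_bot; idx.
- by apply: ew_up; idx.
- by move=> i Hi; apply: ew_far; idx.
Qed.

(** [f k] commutes with the outer generator [e k.+1], so the commutator is computed inside the last
    bracket, on [E k n] or on [E' k k.+2]. The existential [z] gives both cases one shape with the
    same scalar. *)
Lemma E'_f_adjacent k : (1 <= k < n)%N ->
  exists z, br 1 (E' k k.+1) (f k) = z /\ qc (s ^+ 2 / r ^+ 2) (E' k k.+1) z.
Proof.
move=> Hk; have Hw := E'_w_adjacent Hk.
have [Ek | nk] := eqVneq k.+1 n.
  have [||c Hc] := @E_f_first k n; try idx.
  have /qc_br0 He : qc 1 (e n) (f k) by apply: e_f_ne; idx.
  have Hn : qc (s ^+ 2) (E' k k.+1) (e n) by rewrite Ek; apply: E'_e_last; idx.
  rewrite {1 2}Ek Ecal'_n br1_br He br0r addr0 Hc Ek Ecal_id -Ecal'_n.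
  eexists; split; first reflexivity.
  rewrite Ek in Hw Hn *; apply: (qc_brr _ (c := (r ^+ 2)^-1) _ _ Hn); first by rewrite mulrC; field.
  by apply: qcZr; have -> : (r ^+ 2)^-1 = (r ^+ 2 * s ^+ 2)^-1 * s ^+ 2; [field; rewrite r0 s0 | apply: qcMr].
have [||c Hc] := @E'_f_first k k.+2; try idx.
have /qc_br0 He : qc 1 (e k.+1) (f k) by apply: e_f_ne; idx.
have Hn : qc (r ^+ 2)^-1 (E' k k.+1) (e k.+1) by apply: E'_e_top; idx.
have HE : qc (r ^+ 2 * s ^+ 4) (E' k k.+1) (E' k.+1 k.+2).
  apply: (@Ecal'_fromE _ (qcr_br (z := E' k k.+1)) (s ^+ 2) (r ^+ 2 * s ^+ 2)); try idx.
  - by ring.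
  - rewrite E_last; last idx.
    apply: (qc_brr _ (c := (r ^+ 2)^-1) (d := r ^+ 2 * s ^+ 2)); first by field.
      apply: (Ecal_first (qcr_br (z := E' k k.+1))) => //; try idx.
      by move=> i Hi; apply: E'_e_above; idx.
    by apply: E'_e_n; idx.
  - by apply: E'_e_n; idx.
  - by move=> i Hi; apply: E'_e_above; idx.
eexists; split; first by rewrite [X in br 1 X _]Ecal'_S ?br1_br ?He ?br0r ?addr0 ?Hc //; idx.
apply: (qc_brr _ (c := s ^+ 2) _ _ Hn) => //; apply: qcZr.
have -> : s ^+ 2 = (r ^+ 2 * s ^+ 2)^-1 * (r ^+ 2 * s ^+ 4) by field; rewrite r0 s0.
exact: qcMr.
Qed.

Lemma E'_pow_f k j m : (1 <= k < j)%N -> (j <= n)%N -> (1 <= m <= n)%N ->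
  GRing.comm (E' k j ^+ l) (f m).
Proof.
move=> Hk Hj Hm.
have [low | nlow] := boolP ((k < m < j) || (m < k))%N.
  by apply: qc1_pow; apply: E'_f_low; idx.
have [above | nabove] := ltnP j m; first by apply: qc1_pow; apply: E'_f_above; idx.
have [Em | nm1] := eqVneq m k.
  rewrite {}Em; have [<- | nk] := eqVneq k.+1 j.
    have [|z [Hz Hqz]] := @E'_f_adjacent k; first idx.
    apply: (good_comm good_1_s2r2); apply: (ann_lower (c := 1) _ Hqz).
    by rewrite scale1r.
  have [||c Hc] := @E'_f_first k j; try idx.
  apply: (good_comm good_1_s2r2); apply: (ann_lower Hc).
  by rewrite mulrC; apply: qcMr; [apply: E'_w_bot | apply: E'E'_row]; idx.
have -> : m = j by idx.
have [lt_jn | le_nj] := ltnP j n.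
  have [||c Hc] := @E'_f_top k j; try idx.
  apply: (good_comm good_1_r2s2); apply: (ann_lower Hc).
  apply: qcMr; last by apply: E'_w'_top; idx.
  by apply: qc_sym => //; apply: E'E'_column; idx.
have Ejn : j = n by idx.
rewrite {}Ejn in Hk Hj nlow nabove *.
have [|c Hc] := @E'_f_n k; first idx.
apply: (good_comm good_1_r2s2); apply: (ann_lower Hc).
have -> : r ^+ 2 / s ^+ 2 = (s ^+ 2)^-1 * r ^+ 2 by rewrite mulrC.
apply: qcMr.
  apply: qc_sym; first by rewrite invr_eq0.
  by rewrite invrK; apply: EE'_last; idx.
have [|_ Hw] := @E_w_last k; first idx.
rewrite Ecal'_n; apply: (qc_brl _ _ Hw (ew'_last _)); last idx.
by field.
Qed.

(** Against [w m] and [w' m] it matters only that the scalar is an [l]-th root of unity, so its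
    value is hidden. *)
Definition semi_inv z x := exists2 c, c ^+ l = 1 & qc c x z.

Lemma semi_inv_br z k c d t x y :
  k = c * d -> semi_inv z x -> semi_inv z y -> semi_inv z (br t x y).
Proof.
move=> _ [a al Ha] [b bl Hb]; exists (a * b); first by rewrite exprMn al bl mulr1.
exact: (qc_brl _ erefl Ha Hb).
Qed.

Lemma pairing_unity i j : p i j ^+ l = 1.
Proof. by rewrite /pairing; do !case: ifP => _; rewrite !unityE. Qed.

Lemma e_semi_inv i m : (1 <= i <= n)%N -> (1 <= m <= n)%N ->
  semi_inv (w m) (e i) /\ semi_inv (w' m) (e i).
Proof.
move=> Hi Hm; split.
  by exists (p i m)^-1; [rewrite exprVn pairing_unity invr1 | apply: e_w].
by exists (p m i); [rewrite pairing_unity | apply: e_w'].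
Qed.

Lemma E_semi_inv z k j : (1 <= k <= j)%N -> (j <= n)%N ->
  (forall i, (1 <= i <= n)%N -> semi_inv z (e i)) -> semi_inv z (E k j).
Proof.
move=> Hk Hj He; apply: (Ecal_all (Q := fun=> semi_inv z) (@semi_inv_br z) (c := 1)) => //.
by move=> i Hi; apply: He; idx.
Qed.

Lemma E'_semi_inv z k j : (1 <= k < j)%N -> (j <= n)%N ->
  (forall i, (1 <= i <= n)%N -> semi_inv z (e i)) -> semi_inv z (E' k j).
Proof.
move=> Hk Hj He.
apply: (Ecal'_fromE (Q := fun=> semi_inv z) (@semi_inv_br z) (c := 1) (d := 1) (b := 1)).
- exact: Hj.
- by rewrite mulr1.
- by apply: E_semi_inv => //; idx.
- by apply: He; idx.
- by move=> i Hi; apply: He; idx.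
Qed.

Lemma comm_inv x y z : y * z = 1 -> z * y = 1 -> GRing.comm x y -> GRing.comm x z.
Proof.
move=> yz zy xy; rewrite /GRing.comm -[LHS]mul1r -zy -!mulrA; congr (_ * _).
by rewrite [y * _]mulrA -xy -mulrA yz mulr1.
Qed.

Lemma central_intro x :
  (forall m, (1 <= m <= n)%N -> [/\ GRing.comm x (e m), GRing.comm x (f m),
     GRing.comm x (w m) & GRing.comm x (w' m)]) -> central_in_U U x.
Proof.
move=> H m Hm; have [He Hf Hw Hw'] := H m Hm.
have [w1 w2] := w_inv U Hm; have [w1' w2'] := w'_inv U Hm.
by do !split => //; [apply: (comm_inv w1 w2) | apply: (comm_inv w1' w2')].
Qed.

Lemma semi_inv_pow z x : semi_inv z x -> GRing.comm (x ^+ l) z.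
Proof. by case=> c cl /(qc_pow cl). Qed.

Lemma E_pow_central k j : (1 <= k <= j)%N -> (j <= n)%N -> central_in_U U (E k j ^+ l).
Proof.
move=> Hk Hj; apply: central_intro => m Hm; split.
- exact: E_pow_e.
- exact: E_pow_f.
- apply: semi_inv_pow; apply: E_semi_inv => // i Hi.
  by have [] := e_semi_inv Hi Hm.
- apply: semi_inv_pow; apply: E_semi_inv => // i Hi.
  by have [] := e_semi_inv Hi Hm.
Qed.

Lemma E'_pow_central k j : (1 <= k < j)%N -> (j <= n)%N -> central_in_U U (E' k j ^+ l).
Proof.
move=> Hk Hj; apply: central_intro => m Hm; split.
- exact: E'_pow_e.
- exact: E'_pow_f.
- apply: semi_inv_pow; apply: E'_semi_inv => // i Hi.
  by have [] := e_semi_inv Hi Hm.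
- apply: semi_inv_pow; apply: E'_semi_inv => // i Hi.
  by have [] := e_semi_inv Hi Hm.
Qed.

Lemma conj_pow_comm x y yi c : c ^+ l = 1 -> yi * y = 1 -> y * x * yi = c *: x ->
  GRing.comm (y ^+ l) x.
Proof.
move=> cl H1 H; apply: (qc_pow (c := c)) => //.
by rewrite /qc scalerAl -H -[_ * yi * y]mulrA H1 mulr1.
Qed.

Lemma w_pow_central k : (1 <= k <= n)%N ->
  central_in_U U (w k ^+ l - 1) /\ central_in_U U (w' k ^+ l - 1).
Proof.
move=> Hk; have [_ Hw] := w_inv U Hk; have [_ Hw'] := w'_inv U Hk.
have commB x y : GRing.comm (x ^+ l) y -> GRing.comm (x ^+ l - 1) y.
  by move=> H; rewrite /GRing.comm mulrBl mulrBr H mul1r mulr1.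
have commX x y : GRing.comm x y -> GRing.comm (x ^+ l) y.
  by move=> H; apply/commr_sym/commrX/commr_sym.
split; apply: central_intro => m Hm; split; apply: commB.
- by apply: (conj_pow_comm _ Hw (w_e U Hm Hk)); rewrite pairing_unity.
- by apply: (conj_pow_comm _ Hw (w_f U Hm Hk)); rewrite exprVn pairing_unity invr1.
- by apply: commX; have [] := w_comm U Hk Hm.
- by apply: commX; have [] := w_comm U Hk Hm.
- by apply: (conj_pow_comm _ Hw' (w'_e U Hm Hk)); rewrite exprVn pairing_unity invr1.
- by apply: (conj_pow_comm _ Hw' (w'_f U Hm Hk)); rewrite pairing_unity.
- by apply: commX; apply: commr_sym; have [] := w_comm U Hm Hk.
- by apply: commX; have [] := w_comm U Hk Hm.
Qed.

End RootVectors.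

(** * The opposite algebra *)

Definition opp_alg (F : fieldType) (A : algType F) : Type := A.

Section OppositeAlgebra.
Variables (F : fieldType) (A : algType F).
Local Notation B := (opp_alg A).

HB.instance Definition _ := GRing.Lmodule.copy B A.
HB.instance Definition _ := GRing.NzRing.copy B (A^c).

Fact opp_scaleAl (a : F) (x y : B) : a *: (x * y) = @GRing.mul B (a *: x) y.
Proof. exact (@scalerAr F A a y x). Qed.

Fact opp_scaleAr (a : F) (x y : B) : a *: (x * y) = @GRing.mul B x (a *: y).
Proof. exact (@scalerAl F A a y x). Qed.

HB.instance Definition _ := GRing.Lmodule_isLalgebra.Build F B opp_scaleAl.
HB.instance Definition _ := GRing.Lalgebra_isAlgebra.Build F B opp_scaleAr.
End OppositeAlgebra.

Section OppositeRep.
Variables (F : fieldType) (r s : F) (n : nat) (A : algType F).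
Variable U : Urs_rep r s n A.
Hypotheses (r0 : r != 0) (s0 : s != 0).
Local Notation B := (opp_alg A : algType F).

(** Reversing the product inverts the scalar of a conjugation ([opp_conj]); this inversion
    compensates for it. *)
Lemma pairing_swap i j : pairing s r n i j = (pairing r s n j i)^-1.
Proof.
rewrite /pairing; have [-> | nij] := eqVneq i j.
  by case: ifP => _; rewrite invf_div.
have [up | nup] := boolP ((j == i.+1) && (i < n))%N.
  have -> : ((i == j.+1) && (j < n))%N = false by idx.
  by [].
by case: ifP => _; rewrite ?invrK ?invr1.
Qed.

Lemma opp_conj (x y yi : A) c : c != 0 -> yi * y = 1 -> y * x * yi = c *: x ->
  yi * (x * y) = c^-1 *: x.
Proof.
move=> c0 H1 H; apply: (scalerI c0); rewrite scalerA divff // scale1r scalerAr scalerAl.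
by rewrite -H -[_ * yi * y]mulrA H1 mulr1 !mulrA H1 mul1r.
Qed.

Let p0 i j : pairing r s n i j != 0.
Proof. exact: pairing_neq0. Qed.

Lemma opp_w_inv i : (1 <= i <= n)%N ->
  (w' U i : B) * w'inv U i = 1 /\ (w'inv U i : B) * w' U i = 1.
Proof. by move=> Hi; have [H1 H2] := w'_inv U Hi. Qed.

Lemma opp_w'_inv i : (1 <= i <= n)%N ->
  (w U i : B) * winv U i = 1 /\ (winv U i : B) * w U i = 1.
Proof. by move=> Hi; have [H1 H2] := w_inv U Hi. Qed.

Lemma opp_w_comm i j : (1 <= i <= n)%N -> (1 <= j <= n)%N ->
  [/\ GRing.comm (w' U i : B) (w' U j), GRing.comm (w' U i : B) (w U j)
    & GRing.comm (w U i : B) (w U j)].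
Proof.
move=> Hi Hj; have [H1 _ H3] := w_comm U Hi Hj; have [_ H2 _] := w_comm U Hj Hi.
by split; apply: esym.
Qed.

Lemma opp_w_e i j : (1 <= i <= n)%N -> (1 <= j <= n)%N ->
  (w' U j : B) * f U i * w'inv U j = pairing s r n i j *: (f U i : B).
Proof.
move=> Hi Hj; rewrite pairing_swap; have [_ H] := w'_inv U Hj.
exact: (opp_conj (p0 j i) H (w'_f U Hi Hj)).
Qed.

Lemma opp_w_f i j : (1 <= i <= n)%N -> (1 <= j <= n)%N ->
  (w' U j : B) * e U i * w'inv U j = (pairing s r n i j)^-1 *: (e U i : B).
Proof.
move=> Hi Hj; rewrite pairing_swap; have [_ H] := w'_inv U Hj.
by apply: (opp_conj _ H (w'_e U Hi Hj)); rewrite invr_eq0.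
Qed.

Lemma opp_w'_e i j : (1 <= i <= n)%N -> (1 <= j <= n)%N ->
  (w U j : B) * f U i * winv U j = (pairing s r n j i)^-1 *: (f U i : B).
Proof.
move=> Hi Hj; rewrite pairing_swap; have [_ H] := w_inv U Hj.
by apply: (opp_conj _ H (w_f U Hi Hj)); rewrite invr_eq0.
Qed.

Lemma opp_w'_f i j : (1 <= i <= n)%N -> (1 <= j <= n)%N ->
  (w U j : B) * e U i * winv U j = pairing s r n j i *: (e U i : B).
Proof.
move=> Hi Hj; rewrite pairing_swap; have [_ H] := w_inv U Hj.
exact: (opp_conj (p0 i j) H (w_e U Hi Hj)).
Qed.

Lemma opp_e_f i j : (1 <= i <= n)%N -> (1 <= j <= n)%N ->
  (f U i : B) * e U j - (e U j : B) * f U i =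
    (if i == j then (ri s n i - si r n i)^-1 *: ((w' U i : B) - w U i) else 0).
Proof.
move=> Hi Hj; rewrite eq_sym.
apply: (etrans (e_f U Hj Hi)); case: eqP => [-> | //].
have -> : ri s n i - si r n i = - (ri r n i - si s n i) by rewrite opprB.
by rewrite invrN scaleNr -scalerN opprB.
Qed.

Lemma opp_adl : @adl_e F B (f U) (w' U) (w'inv U) =2 adr_f (f U) (w' U) (w'inv U).
Proof. by move=> i b; rewrite /adr_f -!mulrA. Qed.

Lemma opp_serre_e i j : (1 <= i <= n)%N -> (1 <= j <= n)%N -> i != j ->
  iter `|1 - cartanB n i j|%N (@adl_e F B (f U) (w' U) (w'inv U) i) (f U j) = 0.
Proof.
move=> Hi Hj nij; rewrite (eq_iter (opp_adl i)); exact (serre_f U Hi Hj nij).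
Qed.

Lemma opp_adr : @adr_f F B (e U) (w U) (winv U) =2 adl_e (e U) (w U) (winv U).
Proof. by move=> i b; rewrite /adl_e -!mulrA. Qed.

Lemma opp_serre_f i j : (1 <= i <= n)%N -> (1 <= j <= n)%N -> i != j ->
  iter `|1 - cartanB n i j|%N (@adr_f F B (e U) (w U) (winv U) i) (e U j) = 0.
Proof.
move=> Hi Hj nij; rewrite (eq_iter (opp_adr i)); exact (serre_e U Hi Hj nij).
Qed.

(** The dictionary exchanges [e] with [f] and [w] with [w'], keeping each inverse with its element.
    In the [e]-[f] relation the signs from [w' - w] and from swapping [r] and [s] in the denominator
    cancel. *)
Definition opp_rep : Urs_rep s r n B :=
  Build_Urs_rep opp_w_inv opp_w'_inv opp_w_comm opp_w_e opp_w_f opp_w'_e opp_w'_f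
    opp_e_f opp_serre_e opp_serre_f.

Lemma opp_Ecal k j : Ecal opp_rep k j = Fcal U k j.
Proof. by rewrite /Ecal /Fcal; elim: (j - k)%N => //= i ->. Qed.

Lemma opp_Ecal' k j : Ecal' opp_rep k j = Fcal' U k j.
Proof.
rewrite /Ecal' /Fcal'; elim: (n - j)%N => [|i /= ->] /=; last by [].
by rewrite opp_Ecal [s * r]mulrC.
Qed.

Lemma opp_exp (x : A) l : (x : B) ^+ l = x ^+ l.
Proof. by elim: l => // l IH; rewrite exprSr [RHS]exprS IH. Qed.

Lemma opp_central (x : A) : central_in_U opp_rep x -> central_in_U U x.
Proof.
move=> H i Hi; have [[Hf He Hw' Hw'i] [Hw Hwi]] := H i Hi.
by do !split; apply: esym.
Qed.
End OppositeRep.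

Unset Implicit Arguments.

Theorem theorem3p15 (F : fieldType) (n d d' : nat) (r s : F)
  (hF : [pchar F] =i pred0)
  (hn : (2 <= n)%N)
  (hr : d.-primitive_root r) (hs : d'.-primitive_root s)
  (h3 : r ^+ 3 != s ^+ 3) (h4 : r ^+ 4 != s ^+ 4)
  (A : algType F) (U : Urs_rep r s n A) :
  let l := lcmn d d' in
  [/\ (forall k j, (1 <= k <= j)%N -> (j <= n)%N ->
         central_in_U U (Ecal U k j ^+ l)),
      (forall k j, (1 <= k < j)%N -> (j <= n)%N ->
         central_in_U U (Ecal' U k j ^+ l)),
      (forall k j, (1 <= k <= j)%N -> (j <= n)%N ->
         central_in_U U (Fcal U k j ^+ l)),
      (forall k j, (1 <= k < j)%N -> (j <= n)%N ->
         central_in_U U (Fcal' U k j ^+ l)) &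
      (forall k, (1 <= k <= n)%N ->
         central_in_U U (w U k ^+ l - 1) /\ central_in_U U (w' U k ^+ l - 1))].
Proof.
move=> l.
have l0 : (0 < l)%N.
  by rewrite lcmn_gt0 (prim_order_gt0 hr) (prim_order_gt0 hs).
have rl : r ^+ l = 1 by apply/eqP; rewrite -(prim_order_dvd hr) dvdn_lcml.
have sl : s ^+ l = 1 by apply/eqP; rewrite -(prim_order_dvd hs) dvdn_lcmr.
have r0 : r != 0.
  by apply: contra_eq_neq rl => ->; rewrite expr0n gtn_eqF // eq_sym oner_neq0.
have s0 : s != 0.
  by apply: contra_eq_neq sl => ->; rewrite expr0n gtn_eqF // eq_sym oner_neq0.
have h2 : r ^+ 2 + s ^+ 2 != 0.
  apply: contraNneq h4 => H; rewrite -subr_eq0.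
  by have -> : r ^+ 4 - s ^+ 4 = (r ^+ 2 - s ^+ 2) * (r ^+ 2 + s ^+ 2);
    [ring | rewrite H mulr0].
have h2m : r ^+ 2 != s ^+ 2.
  by apply: contraNneq h4 => H; rewrite -[4%N]/(2 * 2)%N !exprM H.
have h33 : r ^+ 2 + r * s + s ^+ 2 != 0.
  apply: contraNneq h3 => H; rewrite -subr_eq0.
  by have -> : r ^+ 3 - s ^+ 3 = (r - s) * (r ^+ 2 + r * s + s ^+ 2);
    [ring | rewrite H mulr0].
(* The same conditions with [r] and [s] exchanged, as needed for the opposite algebra. *)
have h2' : s ^+ 2 + r ^+ 2 != 0 by rewrite addrC.
have h33' : s ^+ 2 + s * r + r ^+ 2 != 0.
  by have -> : s ^+ 2 + s * r + r ^+ 2 = r ^+ 2 + r * s + s ^+ 2 by ring.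
have h2m' : s ^+ 2 != r ^+ 2 by rewrite eq_sym.
split=> [k j Hk Hj|k j Hk Hj|k j Hk Hj|k j Hk Hj|k Hk].
- exact: E_pow_central.
- exact: E'_pow_central.
- by apply: (@opp_central _ _ _ _ _ U r0 s0); rewrite -opp_exp -(opp_Ecal U r0 s0); apply: E_pow_central.
- by apply: (@opp_central _ _ _ _ _ U r0 s0); rewrite -opp_exp -(opp_Ecal' U r0 s0); apply: E'_pow_central.
- exact: w_pow_central.
Qed.
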